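(* Let $p\geq q>0$, let $a<b$ be real numbers and let $\ell>0$. Let $f:[a,b]\to\mathbb{R}^+$ be Riemann integrable with $\frac{1}{b-a}\int_a^b f(u)\,du=\ell$. Then $$\int_a^b\left(\frac{1}{t-a}\int_a^t f(u)\,du\right)^{-p}dt \;\leq\; \left(\frac{p+1}{p}\right)^q\int_a^b\left(\frac{1}{t-a}\int_a^t f(u)\,du\right)^{-p+q}f^{-q}(t)\,dt \;-\; \frac{q}{p+1}\,(b-a)\,\ell^{-p}.$$ Moreover, for fixed $p,q,a,b,\ell$ this inequality is sharp in the class of all Riemann integrable $f:[a,b]\to\mathbb{R}^+$ with $\frac{1}{b-a}\int_a^b f=\ell$, in the following sense: the constant $\left(\frac{p+1}{p}\right)^q$ in front of the integral on the right-hand side cannot be replaced by any smaller constant (keeping the last term unchanged), and the constant $\frac{q}{p+1}(b-a)$ in front of $\ell^{-p}$ cannot be replaced by any larger constant (keeping the constant $\left(\frac{p+1}{p}\right)^q$ unchanged), if the inequality is to hold for all $f$ in this class.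
   Context: $\mathbb{R}^+=(0,\infty)$. $f^{-q}(t)$ denotes $(f(t))^{-q}$. Integrals of non-negative functions are allowed to take the value $+\infty$. *)

(* Defs.v *)
From Stdlib Require Import Rdefinitions.
From mathcomp Require Import all_boot all_order all_algebra.
From mathcomp Require Import all_classical all_reals all_analysis.
From mathcomp Require Import Rstruct Rstruct_topology.
From Coquelicot Require Hierarchy RInt.

Set Implicit Arguments.
Unset Strict Implicit.
Unset Printing Implicit Defensive.

Import Order.TTheory GRing.Theory Num.Theory.
Import numFieldNormedType.Exports.

Local Open Scope classical_set_scope.
Local Open Scope ring_scope.

(* Stdlib's [R] is used, as a [realType], so that the inner integrals can be
   Coquelicot's Riemann integrals.  Coquelicot is not imported: its notations
   and names clash with those of MathComp-Analysis. *)
Definition riemann_integrable (f : R -> R) (a b : R) : Prop :=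
  @RInt.ex_RInt Hierarchy.R_NormedModule f a b.

Definition riemann_int (f : R -> R) (a b : R) : R :=
  @RInt.RInt Hierarchy.R_CompleteNormedModule f a b.

Definition mean (f : R -> R) (a t : R) := (t - a)^-1 * riemann_int f a t.

(* A function on [a, b] is encoded by a total function, of which only the
   values on [a, b] matter. *)
Definition admissible (a b l : R) (f : R -> R) : Prop :=
  [/\ riemann_integrable f a b,
      (forall t, a <= t <= b -> 0 < f t) &
      mean f a b = l].

(* The integrands [mean f a t `^ (- p)] and [f t `^ (- q)] may be unbounded and
   their integrals infinite, so the outer integrals are Lebesgue integrals with
   values in [\bar R].  The completed measure is needed because a Riemann
   integrable function is Lebesgue measurable, but not always Borel measurable.
   The mean is meaningless at [t = a] (where [0^-1 = 0] makes it [0]), but this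
   point has measure zero. *)
Definition mean_int (p a b : R) (f : R -> R) : \bar R :=
  (\int[@completed_lebesgue_measure R]_(t in (`[a, b] : set R))
     (mean f a t `^ (- p))%:E)%E.

Definition mixed_int (p q a b : R) (f : R -> R) : \bar R :=
  (\int[@completed_lebesgue_measure R]_(t in (`[a, b] : set R))
     (mean f a t `^ (- p + q) * f t `^ (- q))%:E)%E.

Definition hardy_ineq (p q a b l C D : R) (f : R -> R) : Prop :=
  (mean_int p a b f <= C%:E * mixed_int p q a b f - (D * l `^ (- p))%:E)%E.

(* Otherwise these arguments would be parsed in [R_scope], bound to [R]. *)
Arguments hardy_ineq (p q a b l C D)%_ring_scope f.

(* Main.v *)
Require Import Defs.
From Stdlib Require Import Rdefinitions.
From mathcomp Require Import all_boot all_order all_algebra.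
From mathcomp Require Import all_classical all_reals all_analysis.
From mathcomp Require Import Rstruct Rstruct_topology.
From mathcomp Require Import measurable_realfun ring lra.
From Stdlib Require RList RiemannInt_SF RiemannInt Rseries.
From Stdlib Require Exp_prop Rpower Rtrigo_def Ranalysis1 RIneq.
From Coquelicot Require Hierarchy Derive RInt RInt_analysis.

(** Write F t for the integral of f over [a, t], M t = F t / (t - a) for the
    running mean, c = (p + 1) / p and k = q / (p + 1).

    The idea is one line of calculus.  The tangent of y^-q at y = 1 gives
    y^-q >= 1 + q - q y for y > 0.  With y = f / (c M), multiplied by M^-p,
    this reads

      c^q M^(q-p) f^-q >= M^-p + k ((p + 1) M^-p - p M^(-p-1) f),

    and the bracket is the derivative of the potential G t = (t - a) (M t)^-p.
    Integration over [a, b] yields the inequality, the subtracted term being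
    k (G b), provided that G tends to 0 at a along some sequence.

    As f is merely Riemann integrable, F need not be differentiable at every
    point.  The integration is therefore carried out on the cells of the
    geometric partition t_i = a + (b - a) r^i with 0 < r < 1, and r tends to 1
    at the very end.  Three remarks replace all continuity arguments by
    explicit factors that tend to 1 with r:
    - the tangent bound is affine and decreasing in f, so on a cell its
      integral is controlled by upper step functions of f, that is, by the
      Riemann integral of f alone ([lower_integral_ge_affine]);
    - (t - a)^(p+1) y^-p is convex in (t, y), so that the increment of G over
      a cell is at most its first-order expansion at the right end
      ([potential_increment]);
    - F = (t - a) M is nondecreasing, so inside a cell M exceeds its value at
      the right end at most by the factor 1 / r ([le_mean_scale]).
    They combine into [mixed_cell_ge_potential].  Another tangent point shows
    that the mixed integral over the cell of t_i is at least a fixed positive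
    multiple of G t_i ([mixed_cell_ge_height]).  Hence, if the mixed integral
    is finite, the G t_i are summable, the boundary terms at a disappear, and
    summation over the cells gives [potential_sum_le] and then
    [mean_int_le_geo].  If the mixed integral is infinite there is nothing to
    prove.

    For sharpness, take f with M t = l ((t - a) / (b - a))^al, 0 < al < 1 / p.
    Then f = (1 + al) M, so the mixed integral is (1 + al)^-q times the
    integral I of M^-p, and I = l^-p (b - a) / (1 - al p).  If C < c^q, some
    al has C <= (1 + al)^q, and the inequality would say that I is at most I
    minus something positive.  As for the other
    constant, (c^q (1 + al)^-q - 1) / (1 - al p) tends to k as al tends to
    1 / p, so the term subtracted on the right cannot exceed
    k (b - a) l^-p. *)

Set Implicit Arguments.
Unset Strict Implicit.
Unset Printing Implicit Defensive.

Import Order.TTheory GRing.Theory Num.Theory.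
Import numFieldNormedType.Exports.

Local Open Scope classical_set_scope.
Local Open Scope ring_scope.

(** * Integrals of arbitrary non-negative functions *)

Section LowerIntegral.
Context d (T : measurableType d) (K : realType).
Variable mu : {measure set T -> \bar K}.
Local Open Scope ereal_scope.
Import HBNNSimple.

(** The integral of a non-negative function is a supremum over the simple
    functions below it, so it is monotone for arbitrary functions.  A simple
    function below f becomes one below g, with the same integral, when it is
    set to 0 on N. *)
Lemma le_integral_off_null (D N : set T) (f g : T -> \bar K) :
  measurable N -> mu N = 0 ->
  (forall x, D x -> 0 <= f x) -> (forall x, D x -> 0 <= g x) ->
  (forall x, D x -> ~ N x -> f x <= g x) ->
  \int[mu]_(x in D) f x <= \int[mu]_(x in D) g x.
Proof.
move=> mN N0 f0 g0 fg; rewrite !ge0_integralE//.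
apply: ge_ereal_sup => _ [h /= hf <-].
have mCN : measurable (~` N) by exact: measurableC.
have -> : sintegral mu h = sintegral mu (proj_nnsfun h mCN).
  rewrite -!integralT_nnsfun.
  have mh : measurable_fun [set: T] (fun x => (h x)%:E) by exact/measurable_EFinP.
  rewrite (@ge0_negligible_integral _ _ _ mu setT N)//; last first.
    by move=> x _; rewrite lee_fin.
  rewrite setTD integral_mkcond; apply: eq_integral => x _ /=.
  rewrite /patch /= mindicE; case: ifPn => _; by rewrite ?mulr1 ?mulr0.
apply: ereal_sup_ubound; exists (proj_nnsfun h mCN) => //= x.
rewrite mindicE; have := hf x; rewrite /patch.
case: ifPn => [/set_mem Dx hfx|Dx hfx].
  have [/set_mem CNx|CNx] := boolP (x \in ~` N).
    by rewrite mulr1 (le_trans hfx)// fg.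
  by rewrite mulr0 g0.
have [/set_mem CNx|CNx] := boolP (x \in ~` N); first by rewrite mulr1.
by rewrite mulr0.
Qed.

Lemma le_integral_pointwise (D : set T) (f g : T -> \bar K) :
  (forall x, D x -> 0 <= f x) -> (forall x, D x -> f x <= g x) ->
  \int[mu]_(x in D) f x <= \int[mu]_(x in D) g x.
Proof.
move=> f0 fg; apply: (@le_integral_off_null _ set0) => // [x Dx|x Dx _].
  by rewrite (le_trans (f0 _ Dx))// fg.
exact: fg.
Qed.

(** Simple functions below f on A and below f on B add up to one below f on D.
    For an arbitrary f only this half of additivity holds: the integral is a
    lower integral. *)
Lemma integral_setU_superadd (A B D : set T) (f : T -> \bar K) :
  A `<=` D -> B `<=` D -> [disjoint A & B] -> (forall x, D x -> 0 <= f x) ->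
  \int[mu]_(x in A) f x + \int[mu]_(x in B) f x <= \int[mu]_(x in D) f x.
Proof.
move=> AD BD /disj_setPS AB f0.
have f0A x : A x -> 0 <= f x by move/AD; exact: f0.
have f0B x : B x -> 0 <= f x by move/BD; exact: f0.
have [iD|] := boolP (\int[mu]_(x in D) f x == +oo).
  by rewrite (eqP iD) leey.
have D0 : 0 <= \int[mu]_(x in D) f x by exact: integral_ge0.
have lefD (C : set T) : C `<=` D ->
    forall h : {nnsfun T >-> K}, (forall x, (h x)%:E <= (f \_ C) x) ->
    forall x, (h x)%:E <= (f \_ D) x.
  move=> CD h hf x; rewrite (le_trans (hf x))// /patch.
  case: ifPn => [/set_mem /CD Dx|_]; first by rewrite mem_set.
  by case: ifPn => // /set_mem /f0.
move=> iDoo; have iDfin : \int[mu]_(x in D) f x \is a fin_num.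
  by rewrite ge0_fin_numE// ltey.
(* As the integral over D is finite, so are all the terms, and the sum of the
   two suprema is bounded by moving one summand at a time to the other side. *)
rewrite -leeBrDr; last first.
  rewrite ge0_fin_numE ?integral_ge0//.
  rewrite (@le_lt_trans _ _ (\int[mu]_(x in D) f x))// ?ltey//.
  rewrite (ge0_integralE _ f0B) (ge0_integralE _ f0).
  apply: le_ereal_sup => _ [h /= hf <-]; exists h => //=; exact: lefD hf.
rewrite (ge0_integralE _ f0A); apply: ge_ereal_sup => _ [h /= hf <-].
have hDfin : sintegral mu h \is a fin_num.
  rewrite ge0_fin_numE ?sintegral_ge0//.
  rewrite (@le_lt_trans _ _ (\int[mu]_(x in D) f x))// ?ltey//.
  rewrite (ge0_integralE _ f0).
  by apply: ereal_sup_ubound; exists h => //=; exact: lefD hf.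
rewrite leeBrDr; last first.
  rewrite ge0_fin_numE ?integral_ge0//.
  rewrite (@le_lt_trans _ _ (\int[mu]_(x in D) f x))// ?ltey//.
  rewrite (ge0_integralE _ f0B) (ge0_integralE _ f0).
  apply: le_ereal_sup => _ [h' /= hf' <-]; exists h' => //=; exact: lefD hf'.
rewrite addeC -leeBrDr//.
rewrite (ge0_integralE _ f0B); apply: ge_ereal_sup => _ [k /= kf <-].
rewrite leeBrDr// addeC -sintegralD//.
rewrite (ge0_integralE _ f0); apply: ereal_sup_ubound.
exists (add_nnsfun h k) => //= x.
have := hf x; have := kf x; rewrite /patch.
have [/set_mem Ax|_] := boolP (x \in A).
  rewrite memNset ?mem_set; [|exact: AD|by move=> Bx; apply: (AB x)].
  move=> kx hx; rewrite EFinD -(adde0 (f x)); exact: leeD.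
case: ifPn => [/set_mem Bx kx hx|_ kx hx].
  rewrite mem_set; last exact: BD.
  by rewrite EFinD -(add0e (f x)); exact: leeD.
apply: (@le_trans _ _ 0); first by rewrite EFinD -(adde0 0); exact: leeD.
by case: ifPn => // /set_mem /f0.
Qed.

Lemma integrable_indicZ (k : K) (A : set T) : measurable A -> mu A < +oo ->
  mu.-integrable setT (fun x => (k * \1_A x)%:E).
Proof.
move=> mA Aoo; under eq_fun do rewrite EFinM.
apply: integrableZl => //; apply/integrableP; split.
  exact/measurable_EFinP/measurable_indic.
rewrite (eq_integral (fun x => (\1_A x)%:E)); last first.
  by move=> t _; rewrite gee0_abs// lee_fin.
by rewrite integral_indic// setIT.
Qed.

Lemma integral_indicZ (k : K) (A : set T) : measurable A -> mu A < +oo ->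
  \int[mu]_x (k * \1_A x)%:E = k%:E * mu A.
Proof.
move=> mA Aoo; under eq_integral do rewrite EFinM.
have iA : mu.-integrable setT (fun x => (\1_A x : K)%:E).
  have := integrable_indicZ 1 mA Aoo.
  by congr (mu.-integrable setT _); apply/funext => x; rewrite mul1r.
by rewrite (@integralZl _ _ _ mu setT)// integral_indic// setIT.
Qed.

Lemma integral_scale_le (D : set T) (k : K) (f : T -> \bar K) :
  (0 < k)%R -> (forall x, D x -> 0 <= f x) ->
  \int[mu]_(x in D) (k%:E * f x) <= k%:E * \int[mu]_(x in D) f x.
Proof.
move=> k0 f0; have k0' := ltW k0; have kV0 : (0 <= k^-1)%R by rewrite invr_ge0.
rewrite !ge0_integralE//; last by move=> x Dx; rewrite mule_ge0// f0.
apply: ge_ereal_sup => _ [h /= hf <-].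
have -> : sintegral mu h = k%:E * sintegral mu (scale_nnsfun h kV0).
  rewrite -sintegralrM; apply: eq_sintegral => x /=.
  by rewrite mulVKf// gt_eqF.
apply: lee_wpmul2l => //; apply: ereal_sup_ubound; exists (scale_nnsfun h kV0) => //= x.
have := hf x; rewrite /patch EFinM; case: ifPn => _ hx.
  by rewrite lee_pdivrMl.
rewrite -EFinM lee_fin pmulr_rle0 ?invr_gt0//.
Qed.
End LowerIntegral.

(** * Step functions and the completed Lebesgue measure *)

Local Notation mu := (@completed_lebesgue_measure R).
Local Notation cR := (caratheodory_type ((wlength (idfun : R -> R))^*)%mu).

Lemma measurable_itv_completed (i : interval R) :
  measurable ([set` i] : set cR).
Proof.
have h := @measurable_itv R i.
exact: sub_caratheodory h.
Qed.

Lemma completed_lebesgue_measure_itv (i : interval R) :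
  mu [set` i] = @lebesgue_measure R [set` i].
Proof. by []. Qed.

Lemma completed_lebesgue_measure_oc (s t : R) :
  s <= t -> mu `]s, t] = (t - s)%:E.
Proof.
rewrite completed_lebesgue_measure_itv lebesgue_measure_itv /= lte_fin.
by case: ltgtP => // <- _; rewrite subrr.
Qed.

Lemma completed_lebesgue_measure_oo (s t : R) :
  s <= t -> mu `]s, t[ = (t - s)%:E.
Proof.
rewrite completed_lebesgue_measure_itv lebesgue_measure_itv /= lte_fin.
by case: ltgtP => // <- _; rewrite subrr.
Qed.

Lemma completed_lebesgue_measure_set1 (s : R) : mu [set s] = 0%E.
Proof.
by rewrite -set_itv1 completed_lebesgue_measure_itv lebesgue_measure_itv /= ltxx.
Qed.

Lemma measurable_set1_completed (s : R) : measurable ([set s] : set cR).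
Proof. by rewrite -set_itv1; exact: measurable_itv_completed. Qed.

(** Integration over the whole line of a function that vanishes outside ]s, t]
    turns concatenation of intervals into addition of functions. *)
Definition integrates_to (s t : R) (g : R -> R) (I : R) : Prop :=
  [/\ mu.-integrable setT (fun x : cR => (g x)%:E),
      (\int[mu]_x (g x)%:E)%E = I%:E &
      forall x, ~~ (s < x <= t) -> g x = 0].

(** A step function is constrained only inside the open cells, so its value at
    the right end has to be carried along; it has no weight in the integral. *)
Lemma integrates_to_piece (s t c : R) (psi : R -> R) : s <= t ->
  (forall x, s < x < t -> psi x = c) ->
  exists2 g, integrates_to s t g (c * (t - s)) &
    forall x, s < x <= t -> g x = psi x.
Proof.
move=> st psic.
have mo : measurable (`]s, t[ : set cR) by exact: measurable_itv_completed.
have m1 := measurable_set1_completed t.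
have oo1 : (mu `]s, t[ < +oo)%E.
  by rewrite completed_lebesgue_measure_oo// ltry.
have i1 := integrable_indicZ c mo oo1.
have e1 : (\int[mu]_x (c * \1_(`]s, t[ : set cR) x)%:E = (c * (t - s))%:E)%E.
  rewrite (integral_indicZ c mo oo1) EFinM; congr (_ * _)%E.
  exact: completed_lebesgue_measure_oo.
have oo2 : (mu [set t] < +oo)%E.
  by rewrite completed_lebesgue_measure_set1.
(* The factor (s < t) makes the function vanish at t when ]s, t] is empty. *)
have i2 := integrable_indicZ (psi t * (s < t)%R%:R) m1 oo2.
have e2 : (\int[mu]_x (psi t * (s < t)%R%:R * \1_([set t] : set cR) x)%:E = 0)%E.
  rewrite (integral_indicZ _ m1 oo2) -[RHS](mule0 (psi t * (s < t)%R%:R)%:E).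
  congr (_ * _)%E; exact: completed_lebesgue_measure_set1.
exists (fun x => c * \1_(`]s, t[ : set cR) x
                 + psi t * (s < t)%R%:R * \1_([set t] : set cR) x).
  split.
  - have := integrableD measurableT i1 i2.
    by congr (integrable _ _ _); apply/funext => x; rewrite /= EFinD.
  - under eq_integral do rewrite EFinD.
    by rewrite (@integralD _ _ _ mu setT)// e1 e2 adde0.
  - move=> x nx; rewrite !indicE !mem_setE in_itv /=.
    have -> : (s < x < t) = false.
      by apply/negP => /andP[sx xt]; move: nx; rewrite sx ltW.
    rewrite mulr0 add0r.
    have [xt|] := eqVneq x t; last by move=> xt; rewrite (memNset) ?mulr0//; exact/eqP.
    by move: nx; rewrite xt lexx andbT => /negbTE ->; rewrite mulr0 mul0r.
move=> x /andP[sx xt]; rewrite !indicE !mem_setE in_itv /= sx /=.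
move: xt; rewrite le_eqVlt => /predU1P[xt|xt].
  by rewrite xt ltxx mulr0 add0r mem_set// mulr1 -xt sx mulr1.
rewrite xt memNset; last by move=> /= xt'; move: xt; rewrite xt' ltxx.
by rewrite mulr0 addr0 mulr1 psic// sx.
Qed.

Lemma integrates_to_add (s t I J : R) (g h : R -> R) :
  integrates_to s t g I -> integrates_to s t h J ->
  integrates_to s t (fun x => g x + h x) (I + J).
Proof.
move=> [ig eg g0] [ih eh h0]; split.
- have -> : (fun x : cR => (g x + h x)%:E) =
            ((fun x : cR => (g x)%:E) \+ (fun x => (h x)%:E))%E.
    by apply/funext => x; rewrite /= EFinD.
  exact: integrableD.
- under eq_integral do rewrite EFinD.
  by rewrite (@integralD _ _ _ mu setT)// eg eh.
- by move=> x nx; rewrite g0// h0// addr0.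
Qed.

Lemma integrates_to_widen (r s t t' I : R) (g : R -> R) :
  r <= s -> t <= t' -> integrates_to s t g I -> integrates_to r t' g I.
Proof.
move=> rs tt' [ig eg g0]; split => // x; rewrite negb_and => /orP xrt.
apply: g0; apply/negP => /andP[sx xt]; case: xrt => /negP; apply.
  exact: le_lt_trans sx.
exact: le_trans tt'.
Qed.

Lemma integrates_to_cat (r s t I J : R) (g h : R -> R) : r <= s -> s <= t ->
  integrates_to r s g I -> integrates_to s t h J ->
  integrates_to r t (fun x => g x + h x) (I + J).
Proof.
move=> rs st ig ih; apply: integrates_to_add.
  exact: (integrates_to_widen (lexx r) st ig).
exact: (integrates_to_widen rs (lexx t) ih).
Qed.

Lemma integrates_to_subdivision (psi : R -> R) (lf l : list R) :
  length l = (length lf).+1 -> RList.ordered_Rlist l ->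
  (forall i, Peano.lt i (Nat.pred (length l)) ->
     Ranalysis1.constant_D_eq psi
      (RiemannInt_SF.open_interval (RList.pos_Rl l i) (RList.pos_Rl l i.+1))
      (RList.pos_Rl lf i)) ->
  RList.pos_Rl l 0 <= RList.pos_Rl l (Nat.pred (length l)) /\
  exists2 g, integrates_to (RList.pos_Rl l 0) (RList.pos_Rl l (Nat.pred (length l)))
       g (RiemannInt_SF.Int_SF lf l) &
    forall x, RList.pos_Rl l 0 < x <= RList.pos_Rl l (Nat.pred (length l)) ->
       g x = psi x.
Proof.
elim: lf l => [|c lf IH] [|x [|y k]] // lk ol hc /=.
  split => //; exists (fun=> 0); last by move=> z /andP[/lt_le_trans/[apply]]; rewrite ltxx.
  split => //; first exact: integrable0.
  by rewrite integral0.
have oyk : RList.ordered_Rlist (y :: k).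
  move=> i /= hi; have /= := ol i.+1; apply.
  exact: (proj1 (PeanoNat.Nat.succ_lt_mono _ _) hi).
have [|||yl [g ig eg]] := IH (y :: k).
- by case: lk => lk; rewrite /= lk.
- exact: oyk.
- move=> i hi; have /= := hc i.+1; apply.
  exact: (proj1 (PeanoNat.Nat.succ_lt_mono _ _) hi).
have xy : x <= y.
  by apply/RlebP; have /= := ol 0%N; apply; exact: PeanoNat.Nat.lt_0_succ.
split; first exact: le_trans yl.
have cxy z : x < z < y -> psi z = c.
  move=> /andP[/RltP xz /RltP zy]; have /= := hc 0%N; apply => //.
  exact: PeanoNat.Nat.lt_0_succ.
have [h ih eh] := integrates_to_piece xy cxy.
exists (fun z => h z + g z).
  exact: integrates_to_cat ih ig.
move=> z /andP[xz zl].
have [zy|yz] := leP z y.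
  rewrite eh ?xz//.
  case: ig => _ _ ->; first by rewrite addr0.
  by rewrite negb_and -leNgt zy.
rewrite eg; last by rewrite yz.
case: ih => _ _ ->; first by rewrite add0r.
by rewrite negb_and -!ltNge yz orbT.
Qed.

Lemma integrates_to_StepFun (s t : R) (phi : RiemannInt_SF.StepFun s t) :
  s <= t ->
  exists2 g, integrates_to s t g (RiemannInt_SF.RiemannInt_SF phi) &
    forall x, s < x <= t -> g x = RiemannInt_SF.fe phi x.
Proof.
move=> st; have /RlebP st' := st.
have [ol [l0 [l1 [ll hc]]]] := RiemannInt_SF.StepFun_P1 phi.
have [] := integrates_to_subdivision ll ol hc.
rewrite l0 l1 Rbasic_fun.Rmin_left// Rbasic_fun.Rmax_right// => _.
rewrite /RiemannInt_SF.RiemannInt_SF; by case: RIneq.Rle_dec.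
Qed.

(** Riemann integrability provides step functions phi and psi with
    |f - phi| <= psi, the integral of phi close to that of f and the integral
    of psi close to 0; phi + psi is the upper step function. *)
Lemma riemann_int_upper_step (f : R -> R) (s t eta : R) : s <= t -> 0 < eta ->
  riemann_integrable f s t ->
  exists g I, [/\ integrates_to s t g I, I <= riemann_int f s t + eta &
    forall x, s < x <= t -> f x <= g x].
Proof.
move=> st eta0 /RInt.ex_RInt_Reals_0 fi; have /RlebP st' := st.
rewrite /riemann_int (RInt.RInt_Reals _ _ _ fi) /RiemannInt.RiemannInt.
case: RiemannInt.RiemannInt_exists => l hl.
have eta2 : Rdefinitions.Rlt 0 (eta / 2)%R by apply/RltP; rewrite divr_gt0.
have [N hN] := hl _ eta2.
have [M hM] := RiemannInt.RinvN_cv eta2.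
pose n := maxn N M.
have /hN : Peano.ge n N by apply/ssrnat.leP; rewrite leq_maxl.
have /hM : Peano.ge n M by apply/ssrnat.leP; rewrite leq_maxr.
set phi := RiemannInt.phi_sequence _ _ _.
have [psi [hpsi ipsi]] := RiemannInt.phi_sequence_prop RiemannInt.RinvN fi n.
move=> Mn Nn.
have [g ig eg] := integrates_to_StepFun phi st.
have [h ih eh] := integrates_to_StepFun psi st.
exists (fun x => g x + h x), (RiemannInt_SF.RiemannInt_SF phi + RiemannInt_SF.RiemannInt_SF psi).
split; first exact: integrates_to_add.
  have [/RltP + _] := Rbasic_fun.Rabs_def2 _ _ ipsi.
  have [/RltP + _] := Rbasic_fun.Rabs_def2 _ _ Mn.
  have [/RltP + _] := Rbasic_fun.Rabs_def2 _ _ Nn.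
  rewrite !RealsE; lra.
move=> x sxt; rewrite eg// eh//.
have /andP[/ltW/RlebP sx /RlebP xt] := sxt.
have hx : Rdefinitions.Rle s x /\ Rdefinitions.Rle x t by [].
have := hpsi x; rewrite Rbasic_fun.Rmin_left// Rbasic_fun.Rmax_right//.
move=> /(_ hx) /(RIneq.Rle_trans _ _ _ (Rbasic_fun.RRle_abs _)) /RleP.
by rewrite -/phi !RealsE lerBlDl.
Qed.

(** * Lebesgue lower bounds from Riemann integrals *)

(** An upper step function g of f gives the integrable lower bound
    al - be * g of m, whose integral is as close as desired to the Riemann
    expression.  Only upper step functions are involved because the slope
    - be is nonpositive. *)
Lemma lower_integral_ge_affine (f m : R -> R) (s t al be : R) :
  s <= t -> riemann_integrable f s t -> 0 <= be ->
  (forall x, s < x <= t -> 0 <= m x) ->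
  (forall x, s < x <= t -> al - be * f x <= m x) ->
  ((al * (t - s) - be * riemann_int f s t)%:E <=
   \int[mu]_(x in (`]s, t] : set R)) (m x)%:E)%E.
Proof.
move=> st fi be0 m0 hm; apply/lee_addgt0Pr => e e0.
have e'0 : 0 < e / (be + 1) by rewrite divr_gt0// ltr_wpDl.
have [g [I [[ig eg g0] hI fg]]] := riemann_int_upper_step st e'0 fi.
have mo : measurable (`]s, t] : set cR) by exact: measurable_itv_completed.
have oo1 : (mu `]s, t] < +oo)%E.
  by rewrite completed_lebesgue_measure_oc// ltry.
have i1 := integrable_indicZ al mo oo1.
have e1 : (\int[mu]_x (al * \1_(`]s, t] : set cR) x)%:E = (al * (t - s))%:E)%E.
  rewrite (integral_indicZ al mo oo1) EFinM; congr (_ * _)%E.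
  exact: completed_lebesgue_measure_oc.
have i2 : mu.-integrable setT (fun x : cR => (be%:E * (g x)%:E)%E).
  exact: integrableZl.
pose h := (fun x : cR => (al * \1_(`]s, t] : set cR) x)%:E - be%:E * (g x)%:E)%E.
have ih : mu.-integrable setT h by exact: integrableB.
have eh : (\int[mu]_x h x = (al * (t - s) - be * I)%:E)%E.
  rewrite (@integralB _ _ _ mu setT)// e1 (@integralZl _ _ _ mu setT)//.
  by rewrite eg EFinB EFinM.
apply: (@le_trans _ _ (al * (t - s) - be * I + e)%:E).
  rewrite lee_fin -addrA lerD2l.
  suff : be * I <= be * riemann_int f s t + e by lra.
  apply: (@le_trans _ _ (be * (riemann_int f s t + e / (be + 1)))).
    by rewrite ler_wpM2l.
  rewrite mulrDr lerD2l mulrCA ler_piMr//; first exact: ltW.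
  by rewrite ler_pdivrMr ?mul1r ?lerDl// ltr_wpDl.
rewrite EFinD leeD2r// -eh.
apply: (@le_trans _ _ (\int[mu]_x h^\+%E x)%E).
  apply: le_integral => //; first exact: integrable_funepos.
  by move=> x _; rewrite funeposE le_max lexx.
rewrite [leRHS]integral_mkcond; apply: le_integral_pointwise => x _.
  by rewrite funeposE le_max lexx orbT.
rewrite funeposE /patch ge_max /h indicE !mem_setE in_itv/=.
case: ifPn => sxt; last by rewrite mulr0 g0// mulr0 oppr0 adde0 lexx.
rewrite [1 *+ _]mulr1n mulr1 -EFinD !lee_fin m0// andbT.
rewrite (le_trans _ (hm x sxt))// lerD2l lerN2 ler_wpM2l//; exact: fg.
Qed.

(** Otherwise f has upper step functions g n with integral at most
    1 / 2^(n+1).  The integral of their sum is at most 1, although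
    this sum dominates the sum of infinitely many copies of f and is
    therefore infinite on ]s, t]. *)
Lemma riemann_int_gt0 (f : R -> R) (s t : R) : s < t ->
  riemann_integrable f s t -> (forall x, s < x <= t -> 0 < f x) ->
  0 < riemann_int f s t.
Proof.
move=> st fi f0; rewrite ltNge; apply/negP => F0.
have eta0 n : 0 < 1 / (2 ^ n.+1)%:R :> R by rewrite divr_gt0// ltr0n expn_gt0.
have /choice [g hg] : forall n, exists g : R -> R,
    exists I, [/\ integrates_to s t g I, I <= 1 / (2 ^ n.+1)%:R &
      forall x, s < x <= t -> f x <= g x].
  move=> n; have [g [I [ig hI fg]]] := riemann_int_upper_step (ltW st) (eta0 n) fi.
  exists g, I; split => //; lra.
have g0 n x : 0 <= g n x.
  have [I [[_ _ gz] _ fg]] := hg n.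
  have [sxt|nsxt] := boolP (s < x <= t); last by rewrite gz.
  by rewrite (le_trans (ltW (f0 x sxt)))// fg.
have mg n : measurable_fun (setT : set cR) (fun x : cR => (g n x)%:E).
  by have [I [[ig _ _] _ _]] := hg n; exact: measurable_int ig.
have mo : measurable (`]s, t] : set cR) by exact: measurable_itv_completed.
have H1 : (\int[mu]_x \sum_(0 <= n <oo) (g n x)%:E <= 1%:E)%E.
  rewrite (@integral_nneseries _ _ _ mu setT)//; last first.
    by move=> n x _; rewrite lee_fin.
  apply: le_trans (@epsilon_trick0 R 1 xpredT ler01).
  apply: lee_nneseries => [n _ _|n _].
    by apply: integral_ge0 => x _; rewrite lee_fin.
  by have [I [[_ -> _] hI _]] := hg n; rewrite lee_fin.
have H2 : (\int[mu]_(x in (`]s, t] : set cR)) cst +oo%E x <=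
           \int[mu]_x \sum_(0 <= n <oo) (g n x)%:E)%E.
  rewrite [leLHS]integral_mkcond; apply: le_integral_pointwise => x _.
    rewrite /patch; case: ifPn => _; [exact: leey|exact: lexx].
  have sum0 : (0 <= \sum_(0 <= n <oo) (g n x)%:E)%E.
    by apply: nneseries_ge0 => n _ _; rewrite lee_fin.
  rewrite /patch !mem_setE in_itv/=; case: ifPn => // sxt.
  rewrite leye_eq; apply/eqP/eqyP => A A0.
  have fx := f0 x sxt.
  pose N := (Num.truncn (A / f x)).+1.
  apply: (@le_trans _ _ (\sum_(0 <= n < N) (g n x)%:E)%E); last first.
    by apply: nneseries_lim_ge => n _ _; rewrite lee_fin.
  rewrite sumEFin lee_fin; apply: (@le_trans _ _ (\sum_(0 <= n < N) f x)).
    rewrite big_const_nat subn0 iter_addr_0 -mulr_natl -ler_pdivrMr//.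
    exact/ltW/truncnS_gt.
  by apply: ler_sum => n _; have [I [_ _ fg]] := hg n; exact: fg.
have := le_trans H2 H1; rewrite (@integral_cst _ _ _ mu)//.
have -> : (+oo * mu `]s, t] = +oo)%E.
  by rewrite completed_lebesgue_measure_oc ?ltW// gt0_mulye// lte_fin subr_gt0.
by [].
Qed.

(** * Real powers and sums *)

Lemma powRD_gt0 (K : realType) (x r s : K) : 0 < x ->
  x `^ (r + s) = x `^ r * x `^ s.
Proof. by move=> x0; apply: powRD; rewrite (gt_eqF x0) implybT. Qed.

(** The convex function x^-e lies above its tangent at 1.  Writing
    x = exp s, this is the sum of exp (- e s) >= 1 - e s and
    e (exp s) >= e (1 + s). *)
Lemma powRN_ge_tangent1 (K : realType) (e x : K) : 0 <= e -> 0 < x ->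
  1 + e - e * x <= x `^ (- e).
Proof.
move=> e0 x0; rewrite /powR gt_eqF//.
have h1 := expR_ge1Dx (- e * ln x).
have h2 := expR_ge1Dx (ln x); rewrite lnK ?posrE// in h2.
have h3 : e * (1 + ln x) <= e * x by rewrite ler_wpM2l.
lra.
Qed.

(** The tangent at z, by homogeneity. *)
Lemma powRN_ge_tangent (K : realType) (e x z : K) : 0 <= e -> 0 < x -> 0 < z ->
  (1 + e) * z `^ (- e) - e * z `^ (- e - 1) * x <= x `^ (- e).
Proof.
move=> e0 x0 z0.
have := powRN_ge_tangent1 e0 (divr_gt0 x0 z0).
rewrite -(ler_pM2l (powR_gt0 (- e) z0)) => h.
have -> : x `^ (- e) = z `^ (- e) * (x / z) `^ (- e).
  by rewrite -powRM ?ltW ?divr_gt0// mulrCA divff ?mulr1// gt_eqF.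
rewrite (le_trans _ h)// powRD_gt0//.
rewrite powR_inv1 ?(ltW z0)//.
have -> : z `^ (- e) * (1 + e - e * (x / z)) =
  (1 + e) * z `^ (- e) - e * (z `^ (- e) / z) * x by field; rewrite gt_eqF.
by [].
Qed.

(** Quantifies how the powers of r tend to 1 when r = 1 / (1 + d) does. *)
Lemma powR_ge_linear (K : realType) (e d : K) : 0 <= e -> 0 < d ->
  1 - e * d <= (1 + d)^-1 `^ e.
Proof.
move=> e0 d0; have d1 : 0 < 1 + d by rewrite addr_gt0.
have -> : (1 + d)^-1 `^ e = (1 + d) `^ (- e).
  by rewrite -(powR_inv1 (ltW d1)) -powRrM mulN1r.
have := powRN_ge_tangent1 e0 d1; lra.
Qed.

Lemma ge0_powRN_anti (K : realType) (e x y : K) : 0 <= e -> 0 < x -> x <= y ->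
  y `^ (- e) <= x `^ (- e).
Proof.
move=> e0 x0 xy; have y0 := lt_le_trans x0 xy.
rewrite !powRN lef_pV2 ?posrE ?powR_gt0//.
by rewrite ge0_ler_powR// nnegrE ltW.
Qed.

Lemma powRN_div (K : realType) (e x r : K) : 0 < x -> 0 < r ->
  (x / r) `^ (- e) = x `^ (- e) * r `^ e.
Proof.
move=> x0 r0; rewrite powRM ?invr_ge0 ?(ltW x0) ?(ltW r0)//; congr (_ * _).
by rewrite -(powR_inv1 (ltW r0)) -powRrM mulN1r opprK.
Qed.

(** Otherwise, from N on, the partial sums grow by at least e at each step and
    eventually exceed B. *)
Lemma bounded_sum_frequently_small (K : archiRealFieldType) (u : nat -> K)
    (B e : K) (N : nat) :
  (forall i, 0 <= u i) -> (forall n, \sum_(i < n) u i <= B) -> 0 < e ->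
  exists2 n, (N <= n)%N & u n < e.
Proof.
move=> u0 hB e0; apply/not_exists2P => h.
pose k := (Num.truncn (B / e)).+1.
have := hB (N + k)%N; apply/negP; rewrite -ltNge.
rewrite big_split_ord/= -[ltLHS]add0r ler_ltD ?sumr_ge0//.
apply: (@lt_le_trans _ _ (\sum_(i < k) e)).
  by rewrite sumr_const card_ord -mulr_natl -ltr_pdivrMr// truncnS_gt.
apply: ler_sum => i _; have [|] := h (N + i)%N; first by rewrite leq_addr.
by move=> /negP; rewrite -leNgt.
Qed.

(** Up to the factor r, a Riemann sum of x^(g-1) on the geometric partition of
    [0, 1], with values at the left ends of the cells; the integral is 1 / g.
    With s = r^g the sum is at most s / (1 - s), and the tangent inequality at
    1 / s with exponent 1 / g gives g (1 - r) s <= 1 - s. *)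
Lemma geometric_sum_le (r g : R) (n : nat) : 0 < r -> r < 1 -> 0 < g ->
  (1 - r) * (\sum_(i < n) (r `^ g) ^+ i.+1) <= g^-1.
Proof.
move=> r0 r1 g0; set s := r `^ g.
have s0 : 0 < s by rewrite powR_gt0.
have tele : (1 - s) * (\sum_(i < n) s ^+ i.+1) = s - s ^+ n.+1.
  elim: n => [|n IH]; first by rewrite big_ord0 mulr0 expr1 subrr.
  rewrite big_ord_recr/= mulrDr IH (exprS s n.+1); ring.
have key : 1 + g * (1 - r) <= s^-1.
  have sV : s^-1 `^ (- g^-1) = r.
    rewrite -(powR_inv1 (ltW s0)) /s -!powRrM.
    have -> : g * (-1 * - g^-1) = 1 by field; rewrite gt_eqF.
    by rewrite powRr1// ltW.
  have gV0 : 0 <= g^-1 by rewrite invr_ge0 ltW.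
  have sV0 : 0 < s^-1 by rewrite invr_gt0.
  have := powRN_ge_tangent1 gV0 sV0; rewrite sV => h.
  have := ler_wpM2l (ltW g0) h.
  have -> : g * (1 + g^-1 - g^-1 * s^-1) = g + 1 - s^-1 by field; rewrite !gt_eqF.
  lra.
have key2 : g * (1 - r) * s <= 1 - s.
  have := ler_wpM2r (ltW s0) key; rewrite mulVf ?gt_eqF//; lra.
have S0 : 0 <= \sum_(i < n) s ^+ i.+1.
  by apply: sumr_ge0 => i _; rewrite exprn_ge0// ltW.
have h1 := ler_wpM2r S0 key2; rewrite tele in h1.
have sn : 0 <= s ^+ n.+1 by rewrite exprn_ge0// ltW.
have h2 : s * (g * ((1 - r) * \sum_(i < n) s ^+ i.+1)) <= s * 1 by lra.
rewrite ler_pM2l// in h2.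
by rewrite -[g^-1]mul1r ler_pdivlMr// mulrC.
Qed.

(** * Running means *)

Section RiemannMean.
Variables (f : R -> R) (a b : R).
Hypotheses (fi : riemann_integrable f a b).

Lemma riemann_integrable_sub (s t : R) : a <= s -> s <= t -> t <= b ->
  riemann_integrable f s t.
Proof.
move=> /RlebP as_ /RlebP st /RlebP tb.
have at_ : Rdefinitions.Rle a t := RIneq.Rle_trans _ _ _ as_ st.
apply: (@RInt.ex_RInt_Chasles_2 Hierarchy.R_CompleteNormedModule f a s t) => //.
exact: (@RInt.ex_RInt_Chasles_1 Hierarchy.R_CompleteNormedModule f a t b).
Qed.

Lemma riemann_int_split (s t : R) : a <= s -> s <= t -> t <= b ->
  riemann_int f a t = riemann_int f a s + riemann_int f s t.
Proof.
move=> as_ st tb; rewrite /riemann_int.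
rewrite -(@RInt.RInt_Chasles Hierarchy.R_CompleteNormedModule f a s t)//.
- exact: riemann_integrable_sub (lexx a) as_ (le_trans st tb).
- exact: riemann_integrable_sub as_ st tb.
Qed.

Hypothesis f0 : forall t, a <= t <= b -> 0 < f t.

Lemma riemann_int_pos (s t : R) : a <= s -> s < t -> t <= b ->
  0 < riemann_int f s t.
Proof.
move=> as_ st tb; apply: riemann_int_gt0 => //.
  exact: riemann_integrable_sub (ltW st) tb.
move=> x /andP[sx xt]; apply: f0.
by rewrite (le_trans as_ (ltW sx)) (le_trans xt tb).
Qed.

Lemma mean_gt0 (t : R) : a < t -> t <= b -> 0 < mean f a t.
Proof. by move=> at_ tb; rewrite mulr_gt0 ?invr_gt0 ?subr_gt0 ?riemann_int_pos. Qed.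

(** Both sides are integrals of f over intervals that start at a. *)
Lemma le_mean_scale (s t : R) : a < s -> s <= t -> t <= b ->
  mean f a s * (s - a) <= mean f a t * (t - a).
Proof.
move=> as_ st tb; rewrite /mean.
have at_ := lt_le_trans as_ st.
rewrite ![_^-1 * _]mulrC !mulfVK ?subr_eq0 ?gt_eqF//.
rewrite (riemann_int_split (ltW as_) st tb) lerDl.
have [<-|] := eqVneq s t.
  by rewrite /riemann_int RInt.RInt_point.
by move=> nst; rewrite ltW// riemann_int_pos ?(ltW as_)// lt_neqAle nst.
Qed.
End RiemannMean.

(** * The inequality on one cell *)

(** The body has to match the integrand of [mixed_int] up to conversion. *)
Definition mixed_integrand (p q a : R) (f : R -> R) (x : R) : R :=
  (mean f a x `^ (- p + q) * f x `^ (- q))%R.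

Section Cell.
Variables (p q a b : R) (f : R -> R).
Hypotheses (q0 : 0 < q) (qp : q <= p).
Hypotheses (fi : riemann_integrable f a b).
Hypotheses (f0 : forall t, a <= t <= b -> 0 < f t).

(** Jensen's inequality on a cell, in tangent form: on ]s, t] the mean is at
    most 1 / r times its value at t, and - (p - q) is a nonpositive exponent;
    f^-q is bounded below by its tangent at z.  The point z is left free
    because it is used twice. *)
Lemma mixed_cell_ge (s t r z : R) : a < s -> s <= t -> t <= b -> 0 < z ->
  s - a = r * (t - a) ->
  ((r `^ (p - q) * mean f a t `^ (- (p - q)) *
    ((1 + q) * z `^ (- q) * (t - s)
     - q * z `^ (- q - 1) * riemann_int f s t))%:E <=
   \int[mu]_(x in (`]s, t] : set R)) (mixed_integrand p q a f x)%:E)%E.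
Proof.
move=> as_ st tb z0 er; have at_ := lt_le_trans as_ st.
have ta0 : 0 < t - a by rewrite subr_gt0.
have r0 : 0 < r by rewrite -(pmulr_lgt0 _ ta0) -er subr_gt0.
have pq0 : 0 <= p - q by rewrite subr_ge0.
set k := r `^ (p - q) * _.
have k0 : 0 <= k by rewrite mulr_ge0// powR_ge0.
rewrite mulrBr mulrA (mulrA k) (mulrA k).
apply: lower_integral_ge_affine => //.
- exact: (riemann_integrable_sub fi (ltW as_) st tb).
- by rewrite !mulr_ge0 ?powR_ge0// ltW.
- by move=> x _; rewrite mulr_ge0 ?powR_ge0.
move=> x /andP[sx xt].
have xb := le_trans xt tb; have ax := lt_trans as_ sx.
have fx : 0 < f x by rewrite f0// xb ltW.
have tg := powRN_ge_tangent (ltW q0) fx z0.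
apply: (@le_trans _ _ (k * f x `^ (- q))).
  have := ler_wpM2l k0 tg; lra.
rewrite ler_wpM2r ?powR_ge0// /k mulrC.
have -> : - p + q = - (p - q) by lra.
have Mt := mean_gt0 fi f0 at_ tb.
rewrite -powRN_div//; apply: ge0_powRN_anti => //.
  exact: (mean_gt0 fi f0 ax xb).
rewrite ler_pdivlMr//.
have h1 := le_mean_scale fi f0 ax xt tb.
have Mx := mean_gt0 fi f0 ax xb.
have h2 : mean f a x * (s - a) <= mean f a x * (x - a).
  by rewrite ler_wpM2l ?(ltW Mx)// lerD2r ltW.
rewrite -(ler_pM2r ta0) -mulrA -er.
exact: le_trans h2 h1.
Qed.

(** The function of t whose derivative, where it exists, is
    (p + 1) M^-p - p M^(-p-1) f with M the running mean. *)
Definition potential (t : R) : R := ((t - a) * mean f a t `^ (- p))%R.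

(** A convex function lies above its tangents: the potential
    (t - a) M^-p = (t - a)^(p+1) F^-p is convex in t and in the primitive F of
    f, and the right-hand side is its first-order variation at t.  The proof
    reduces this to one variable: it is the tangent inequality for the two
    means, multiplied by s - a. *)
Lemma potential_increment (s t : R) : a < s -> s <= t -> t <= b ->
  potential t - potential s <=
  (p + 1) * mean f a t `^ (- p) * (t - s)
  - p * mean f a t `^ (- p - 1) * riemann_int f s t.
Proof.
move=> as_ st tb; have at_ := lt_le_trans as_ st.
have p0 : 0 <= p by rewrite (le_trans (ltW q0)).
have Ms := mean_gt0 fi f0 as_ (le_trans st tb).
have Mt := mean_gt0 fi f0 at_ tb.
have sa0 : 0 < s - a by rewrite subr_gt0.
have ta0 : 0 < t - a by rewrite subr_gt0.
have := ler_wpM2l (ltW sa0) (powRN_ge_tangent p0 Ms Mt).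
have es : riemann_int f a s = mean f a s * (s - a).
  by rewrite /mean mulrAC mulVf ?mul1r// gt_eqF.
have et : riemann_int f a t = mean f a t * (t - a).
  by rewrite /mean mulrAC mulVf ?mul1r// gt_eqF.
have -> : riemann_int f s t = mean f a t * (t - a) - mean f a s * (s - a).
  rewrite -es -et (riemann_int_split fi (ltW as_) st tb); ring.
have -> : mean f a t `^ (- p) = mean f a t * mean f a t `^ (- p - 1).
  rewrite -[X in X * _](powRr1 (ltW Mt)) -powRD_gt0//; congr (_ `^ _); lra.
rewrite /potential.
have -> : mean f a t `^ (- p) = mean f a t * mean f a t `^ (- p - 1).
  rewrite -[X in X * _](powRr1 (ltW Mt)) -powRD_gt0//; congr (_ `^ _); lra.
set Q := mean f a t `^ (- p - 1); set S := mean f a s `^ (- p).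
move: (mean f a t) (mean f a s) Q S => m n Q S.
lra.
Qed.

(** The tangent point is c M with c = (p + 1) / p, where M is the mean at t:
    this is the slope at which the extremal power functions satisfy
    f = c M. *)
Lemma mixed_cell_ge_potential (s t r : R) : a < s -> s <= t -> t <= b ->
  s - a = r * (t - a) ->
  ((r `^ (p - q) * (((p + 1) / p) `^ (- q)) *
    (mean f a t `^ (- p) * (t - s)
     + q / (p + 1) * (potential t - potential s)))%:E <=
   \int[mu]_(x in (`]s, t] : set R)) (mixed_integrand p q a f x)%:E)%E.
Proof.
move=> as_ st tb er; have at_ := lt_le_trans as_ st.
have p0 : 0 < p by rewrite (lt_le_trans q0).
have c0 : 0 < (p + 1) / p by rewrite divr_gt0// addr_gt0.
have Mt := mean_gt0 fi f0 at_ tb.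
have z0 : 0 < (p + 1) / p * mean f a t by rewrite mulr_gt0.
apply: le_trans (mixed_cell_ge as_ st tb z0 er).
rewrite lee_fin -mulrA -[leRHS]mulrA ler_wpM2l ?powR_ge0//.
have -> : ((p + 1) / p * mean f a t) `^ (- q - 1) =
   ((p + 1) / p) `^ (- q) * (p / (p + 1)) * mean f a t `^ (- q - 1).
  rewrite powRM ?(ltW c0) ?(ltW Mt)//; congr (_ * _).
  by rewrite powRD_gt0// powR_inv1 ?(ltW c0)// invf_div.
have -> : ((p + 1) / p * mean f a t) `^ (- q) =
    ((p + 1) / p) `^ (- q) * mean f a t `^ (- q).
  by apply: powRM; exact: ltW.
have e1 : mean f a t `^ (- p) = mean f a t `^ (- (p - q)) * mean f a t `^ (- q).
  rewrite -powRD_gt0//; congr (_ `^ _); lra.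
have e2 : mean f a t `^ (- p - 1) = mean f a t `^ (- (p - q)) * mean f a t `^ (- q - 1).
  rewrite -powRD_gt0//; congr (_ `^ _); lra.
have pp1 : 0 < p + 1 by rewrite addr_gt0.
have k0 : 0 <= q / (p + 1) by rewrite divr_ge0// ltW.
have := ler_wpM2l k0 (potential_increment as_ st tb).
move: (potential t - potential s) => dG.
rewrite e1 e2.
set A := mean f a t `^ (- (p - q)); set B := mean f a t `^ (- q).
set C := mean f a t `^ (- q - 1); set c := ((p + 1) / p) `^ (- q).
move: (riemann_int f s t) => dF h.
have c'0 : 0 <= c by rewrite powR_ge0.
have {h} := ler_wpM2l c'0 h.
have -> : c * (q / (p + 1) * ((p + 1) * (A * B) * (t - s) - p * (A * C) * dF))
  = A * ((1 + q) * (c * B) * (t - s) - q * (c * (p / (p + 1)) * C) * dF)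
   - c * (A * B * (t - s)).
  by field; rewrite gt_eqF.
lra.
Qed.

(** The tangent point z = M / (1 - r) bounds the average of f over ]s, t],
    since the integral of f over ]s, t] is at most its integral M (t - a) from a
    and t - s = (1 - r) (t - a).  At such a point the tangent bound is at
    least z^-q (t - s), which controls the potential at t itself and not only
    an increment. *)
Lemma mixed_cell_ge_height (s t r : R) : a < s -> s < t -> t <= b ->
  s - a = r * (t - a) ->
  ((r `^ (p - q) * (1 - r) `^ (1 + q) * potential t)%:E <=
   \int[mu]_(x in (`]s, t] : set R)) (mixed_integrand p q a f x)%:E)%E.
Proof.
move=> as_ st tb er; have at_ := lt_trans as_ st.
have p0 : 0 < p by rewrite (lt_le_trans q0).
have Mt := mean_gt0 fi f0 at_ tb.
have ta0 : 0 < t - a by rewrite subr_gt0.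
have sa0 : 0 < s - a by rewrite subr_gt0.
have ets : t - s = (1 - r) * (t - a) by rewrite mulrBl mul1r -er; ring.
have r1 : 0 < 1 - r by rewrite -(pmulr_lgt0 _ ta0) -ets subr_gt0.
have z0 : 0 < mean f a t / (1 - r) by rewrite divr_gt0.
apply: le_trans (mixed_cell_ge as_ (ltW st) tb z0 er).
rewrite lee_fin -mulrA -[leRHS]mulrA ler_wpM2l ?powR_ge0// /potential.
have et : riemann_int f a t = mean f a t * (t - a).
  by rewrite /mean mulrAC mulVf ?mul1r// gt_eqF.
have dF : riemann_int f s t <= mean f a t / (1 - r) * (t - s).
  rewrite ets mulrA mulfVK ?gt_eqF// -et.
  rewrite (riemann_int_split fi (ltW as_) (ltW st) tb) lerDr ltW//.
  exact: (riemann_int_pos fi f0 (lexx a) as_ (le_trans (ltW st) tb)).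
have e1 : mean f a t `^ (- p) = mean f a t `^ (- (p - q)) * mean f a t `^ (- q).
  rewrite -powRD_gt0//; congr (_ `^ _); lra.
have e2 : (mean f a t / (1 - r)) `^ (- q) = mean f a t `^ (- q) * (1 - r) `^ q.
  exact: powRN_div.
have e3 : (mean f a t / (1 - r)) `^ (- q) = (mean f a t / (1 - r)) *
     (mean f a t / (1 - r)) `^ (- q - 1).
  rewrite -[X in _ = X * _](powRr1 (ltW z0)) -powRD_gt0//; congr (_ `^ _); lra.
rewrite powRD_gt0// powRr1 ?(ltW r1)//.
have -> : (1 - r) * (1 - r) `^ q * ((t - a) * mean f a t `^ (- p)) =
   mean f a t `^ (- (p - q)) * ((mean f a t / (1 - r)) `^ (- q) * (t - s)).
  rewrite e1 e2 ets; ring.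
rewrite ler_wpM2l ?powR_ge0//.
have := ler_wpM2l (mulr_ge0 (ltW q0) (powR_ge0 (mean f a t / (1 - r)) (- q - 1))) dF.
rewrite e3; set W := _ `^ (- q - 1); set Z := mean f a t / (1 - r); lra.
Qed.
End Cell.

(** * Geometric partitions *)

(** Decreasing from b to a.  All cells ]geo i.+1, geo i] look alike when seen
    from a, which makes the error factors independent of i. *)
Definition geo (a b r : R) (i : nat) : R := (a + (b - a) * r ^+ i)%R.

Section GeometricPartition.
Variables (a b r : R).
Hypotheses (ab : a < b) (r0 : 0 < r) (r1 : r < 1).

Let ba0 : 0 < b - a. Proof. by rewrite subr_gt0. Qed.

Lemma geo0 : geo a b r 0 = b.
Proof. by rewrite /geo expr0 mulr1 addrC subrK. Qed.

Lemma geo_gt i : a < geo a b r i.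
Proof. by rewrite ltrDl mulr_gt0// exprn_gt0. Qed.

Lemma geo_ltS i : geo a b r i.+1 < geo a b r i.
Proof. by rewrite ltrD2l ltr_pM2l// exprS gtr_pMl// exprn_gt0. Qed.

Lemma geo_le i : geo a b r i <= b.
Proof.
elim: i => [|i IH]; first by rewrite geo0.
exact: le_trans (ltW (geo_ltS i)) IH.
Qed.

Lemma geoB i : geo a b r i - a = (b - a) * r ^+ i.
Proof. by rewrite /geo addrC addKr. Qed.

Lemma geoSB i : geo a b r i.+1 - a = r * (geo a b r i - a).
Proof. by rewrite !geoB exprS mulrCA. Qed.

Lemma geo_width i : geo a b r i - geo a b r i.+1 = (1 - r) * (geo a b r i - a).
Proof. rewrite mulrBl mul1r -geoSB; ring. Qed.

Lemma geo_cell (x : R) : a < x -> x <= b ->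
  exists i, geo a b r i.+1 < x <= geo a b r i.
Proof.
move=> ax xb.
have ex : exists n, geo a b r n < x.
  have y0 : 0 < (x - a) / (b - a) by rewrite divr_gt0// subr_gt0.
  have rr : `|r| < 1 by rewrite gtr0_norm.
  have /cvgrPdist_lt /(_ _ y0)[N _ hN] := cvg_expr rr.
  exists N; have := hN N (leqnn N).
  rewrite sub0r normrN /= gtr0_norm ?exprn_gt0// ltr_pdivlMr// mulrC.
  by rewrite -geoB ltrD2r.
case: (ex_minnP ex) => -[|i]; first by rewrite geo0 ltNge xb.
move=> xi mini; exists i; rewrite xi /= leNgt; apply/negP => /mini.
by rewrite ltnn.
Qed.

Lemma integral_ge_sum_cells (m : R -> R) (L : nat -> R) (n : nat) :
  (forall x, a <= x <= b -> 0 <= m x) ->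
  (forall i, ((L i)%:E <=
     \int[mu]_(x in (`]geo a b r i.+1, geo a b r i] : set R)) (m x)%:E)%E) ->
  ((\sum_(i < n) L i)%:E <= \int[mu]_(x in (`[a, b] : set R)) (m x)%:E)%E.
Proof.
move=> m0 hL.
have sub i x : geo a b r i < x -> x <= b -> a <= x <= b.
  by move=> ix xb; rewrite xb andbT ltW// (lt_trans _ ix)// geo_gt.
have h : ((\sum_(i < n) L i)%:E <=
    \int[mu]_(x in (`]geo a b r n, b] : set R)) (m x)%:E)%E.
  elim: n => [|n IH].
    rewrite big_ord0; apply: integral_ge0 => x; rewrite /= in_itv/= lee_fin.
    by move=> /andP[/sub] /[apply] /m0.
  rewrite big_ord_recr/= EFinD.
  apply: le_trans (leeD IH (hL n)) _.
  apply: integral_setU_superadd.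
  - move=> x /=; rewrite !in_itv/= => /andP[nx ->]; rewrite andbT.
    exact: lt_trans (geo_ltS n) nx.
  - move=> x /=; rewrite !in_itv/= => /andP[-> nx] /=.
    exact: le_trans nx (geo_le n).
  - apply/disj_setPS => x [] /=; rewrite !in_itv/= => /andP[nx _] /andP[_ xn].
    by have := lt_le_trans nx xn; rewrite ltxx.
  - move=> x /=; rewrite in_itv/= lee_fin => /andP[/sub] /[apply]; exact: m0.
apply: le_trans h _.
rewrite -[leLHS]adde0.
have -> : 0%E = (\int[mu]_(x in (set0 : set R)) (m x)%:E)%E by rewrite integral_set0.
apply: integral_setU_superadd => //.
- by move=> x /=; rewrite !in_itv/= => /andP[nx xb]; exact: sub nx xb.
- by rewrite disj_set2E setI0.
Qed.

(** Comparison with the function equal to u i on the i-th cell; the point a,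
    which lies in no cell, is negligible. *)
Lemma integral_le_sum_cells (m : R -> R) (u : nat -> R) (B : R) :
  (forall x, a <= x <= b -> 0 <= m x) -> (forall i, 0 <= u i) ->
  (forall i x, geo a b r i.+1 < x <= geo a b r i -> m x <= u i) ->
  (forall n, \sum_(i < n) u i * (geo a b r i - geo a b r i.+1) <= B) ->
  (\int[mu]_(x in (`[a, b] : set R)) (m x)%:E <= B%:E)%E.
Proof.
move=> m0 u0 mu_ hB.
pose c i : set cR := [set` `]geo a b r i.+1, geo a b r i] ].
have mc i : measurable (c i) by exact: measurable_itv_completed.
have muc i : mu (c i) = (geo a b r i - geo a b r i.+1)%:E.
  by rewrite completed_lebesgue_measure_oc// ltW// geo_ltS.
have cfin i : (mu (c i) < +oo)%E by rewrite muc ltry.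
have iu i := integrable_indicZ (u i) (mc i) (cfin i).
have ge0 i x : (0 <= (u i * \1_(c i) x)%:E)%E by rewrite lee_fin mulr_ge0.
pose S (x : cR) : \bar R := (\sum_(0 <= i <oo) (u i * \1_(c i) x)%:E)%E.
have S0 x : (0 <= S x)%E by apply: nneseries_ge0 => n _ _.
apply: (@le_trans _ _ (\int[mu]_(x in (`[a, b] : set cR)) S x)%E).
  apply: (@le_integral_off_null _ _ _ mu _ [set a]) => //.
  - exact: measurable_set1_completed.
  - exact: completed_lebesgue_measure_set1.
  move=> x /=; rewrite in_itv/= => /andP[ax xb] /eqP nax.
  have {}ax : a < x by rewrite lt_neqAle eq_sym nax.
  have [i ix] := geo_cell ax xb.
  apply: (@le_trans _ _ (\sum_(0 <= j < i.+1) (u j * \1_(c j) x)%:E)%E); last first.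
    by apply: nneseries_lim_ge => n _ _.
  rewrite sumEFin lee_fin big_nat_recr//=.
  rewrite indicE mem_setE in_itv/= ix mulr1.
  by rewrite (le_trans (mu_ i x ix))// lerDr sumr_ge0// => j _; rewrite mulr_ge0.
apply: (@le_trans _ _ (\int[mu]_x S x)%E).
  rewrite [leLHS]integral_mkcond; apply: le_integral_pointwise => x _.
    by rewrite /patch; case: ifPn => // _; exact: S0.
  rewrite /patch; case: ifPn => // _; exact: S0.
rewrite /S (@integral_nneseries _ _ _ mu setT)//; last first.
  by move=> n; exact: measurable_int (iu n).
apply: lime_le.
  by apply: is_cvg_nneseries => n _ _; apply: integral_ge0.
apply: nearW => n; rewrite big_mkord.
rewrite (eq_bigr (fun i : 'I_n => (u i * (geo a b r i - geo a b r i.+1))%:E)); last first.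
  move=> i _; rewrite (integral_indicZ _ (mc i) (cfin i)) EFinM; congr (_ * _)%E.
  exact: muc.
rewrite sumEFin lee_fin; exact: hB.
Qed.
End GeometricPartition.

(** * The inequality *)

Section Inequality.
Variables (p q a b : R) (f : R -> R).
Hypotheses (q0 : 0 < q) (qp : q <= p) (ab : a < b).
Hypotheses (fi : riemann_integrable f a b).
Hypotheses (f0 : forall t, a <= t <= b -> 0 < f t).

Let p0 : 0 < p. Proof. exact: lt_le_trans q0 qp. Qed.
Let c0 : 0 < (p + 1) / p. Proof. by rewrite divr_gt0// addr_gt0. Qed.
Let G := potential p a f.

Lemma potential_gt0 (t : R) : a < t -> t <= b -> 0 < G t.
Proof.
by move=> at_ tb; rewrite mulr_gt0 ?subr_gt0// powR_gt0// (mean_gt0 fi).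
Qed.

(** On a cell, the width times M^-p, with M taken at the right end, is (1 - r)
    times the potential there, and the increments of the potential telescope.  The boundary term
    G (geo N) left over is removed by choosing N large with G (geo N) small,
    which is possible since the sum of all G (geo i) is finite by
    [mixed_cell_ge_height]. *)
Lemma potential_sum_le (X r : R) (n : nat) : 0 < r -> r < 1 ->
  mixed_int p q a b f = X%:E ->
  (1 - r) * (\sum_(i < n) G (geo a b r i)) + q / (p + 1) * G b <=
  r `^ (q - p) * ((p + 1) / p) `^ q * X.
Proof.
move=> r0 r1 hX.
have m0 x : a <= x <= b -> 0 <= mixed_integrand p q a f x.
  by move=> _; rewrite mulr_ge0 ?powR_ge0.
have k0 : 0 < q / (p + 1) by rewrite divr_gt0// addr_gt0.
have G0 i : 0 <= G (geo a b r i).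
  by rewrite ltW// potential_gt0 ?geo_gt ?geo_le.
pose w := r `^ (p - q) * ((p + 1) / p) `^ (- q).
have w0 : 0 < w by rewrite mulr_gt0 ?powR_gt0.
have wV : r `^ (q - p) * ((p + 1) / p) `^ q = w^-1.
  by rewrite /w -[q - p]opprB powRN powRN invfM invrK.
have h1 N : w * ((1 - r) * (\sum_(i < N) G (geo a b r i))
                 + q / (p + 1) * (G b - G (geo a b r N))) <= X.
  rewrite -lee_fin -hX.
  pose L i := w * (mean f a (geo a b r i) `^ (- p) * (geo a b r i - geo a b r i.+1)
      + q / (p + 1) * (G (geo a b r i) - G (geo a b r i.+1))).
  have -> : w * ((1 - r) * (\sum_(i < N) G (geo a b r i))
                 + q / (p + 1) * (G b - G (geo a b r N))) = \sum_(i < N) L i.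
    elim: N => [|N IH]; first by rewrite !big_ord0 geo0// subrr !mulr0 addr0 mulr0.
    rewrite !big_ord_recr/= -IH /L geo_width /G /potential; ring.
  apply: (integral_ge_sum_cells ab r0 r1) => // i.
  apply: (mixed_cell_ge_potential q0 qp fi f0) => //.
  - exact: geo_gt.
  - exact/ltW/geo_ltS.
  - exact: geo_le.
  - exact: geoSB.
pose d := r `^ (p - q) * (1 - r) `^ (1 + q).
have d0 : 0 < d by rewrite mulr_gt0 ?powR_gt0 ?subr_gt0.
have h2 N : \sum_(i < N) (d * G (geo a b r i)) <= X.
  rewrite -lee_fin -hX.
  apply: (integral_ge_sum_cells ab r0 r1
            (L := fun i => d * G (geo a b r i))) => // i.
  apply: (mixed_cell_ge_height q0 qp fi f0) => //.
  - exact: geo_gt.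
  - exact: geo_ltS.
  - exact: geo_le.
  - exact: geoSB.
rewrite wV [leRHS]mulrC ler_pdivlMr// [leLHS]mulrC.
apply/ler_addgt0Pr => e e0.
have wk0 : 0 < w * (q / (p + 1)) by exact: mulr_gt0.
have e'0 : 0 < d * (e / (w * (q / (p + 1)))).
  by apply: mulr_gt0 => //; exact: divr_gt0.
have [|N nN hN] := @bounded_sum_frequently_small R (fun i => d * G (geo a b r i)) _ _ n _ h2 e'0.
  by move=> i; rewrite mulr_ge0// ltW.
move: hN => /=; rewrite (ltr_pM2l d0) (ltr_pdivlMr _ _ wk0) => hN.
have hS : \sum_(i < n) G (geo a b r i) <= \sum_(i < N) G (geo a b r i).
  rewrite -(subnKC nN) big_split_ord/= lerDl sumr_ge0//.
have := h1 N.
have w1r : 0 <= w * (1 - r) by apply: mulr_ge0; [exact: ltW|rewrite subr_ge0 ltW].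
have := ler_wpM2l w1r hS.
lra.
Qed.

(** On the i-th cell the mean is at least r times its value at the left end, so
    the cell contributes at most r^(-p-1) (1 - r) G (geo i.+1). *)
Lemma mean_int_le_geo (X r : R) : 0 < r -> r < 1 ->
  mixed_int p q a b f = X%:E ->
  (mean_int p a b f <=
   (r `^ (- p - 1) * (r `^ (q - p) * ((p + 1) / p) `^ q * X
      - q / (p + 1) * G b))%:E)%E.
Proof.
move=> r0 r1 hX.
have G0 i : 0 <= G (geo a b r i).
  by rewrite ltW// potential_gt0 ?geo_gt ?geo_le.
have M0 i : 0 < mean f a (geo a b r i) by rewrite (mean_gt0 fi) ?geo_gt ?geo_le.
apply: (@integral_le_sum_cells _ _ r _ _ _ _
          (fun i => (r * mean f a (geo a b r i.+1)) `^ (- p))) => //.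
- by move=> x _; rewrite powR_ge0.
- by move=> i; rewrite powR_ge0.
- move=> i x /andP[ix xi].
  have ax : a < x by rewrite (lt_trans _ ix)// geo_gt.
  have xb : x <= b by rewrite (le_trans xi)// geo_le.
  have Mx := mean_gt0 fi f0 ax xb.
  apply: ge0_powRN_anti; [exact: ltW|by rewrite mulr_gt0|].
  have := le_mean_scale fi f0 (geo_gt ab r0 i.+1) (ltW ix) xb.
  have gi : 0 < geo a b r i - a by rewrite subr_gt0 geo_gt.
  rewrite geoSB mulrCA mulrA => h.
  rewrite -(ler_pM2r gi) (le_trans h)// ler_wpM2l ?(ltW Mx)//.
  by rewrite lerD2r.
move=> n.
have -> : \sum_(i < n) (r * mean f a (geo a b r i.+1)) `^ (- p)
      * (geo a b r i - geo a b r i.+1) =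
   r `^ (- p - 1) * ((1 - r) * \sum_(i < n) G (geo a b r i.+1)).
  rewrite mulrA mulr_sumr; apply: eq_bigr => i _.
  rewrite geo_width /G /potential geoSB powRM ?(ltW r0) ?(ltW (M0 _))//.
  rewrite powRD_gt0// powR_inv1 ?(ltW r0)//; field; by rewrite gt_eqF.
rewrite ler_wpM2l ?powR_ge0//.
have := potential_sum_le n.+1 r0 r1 hX.
rewrite big_ord_recl/=.
have := mulr_ge0 (_ : 0 <= 1 - r) (G0 0%N); rewrite subr_ge0 (ltW r1) => /(_ isT).
set S := \sum_(i < n) _.
rewrite geo0; lra.
Qed.

(** The limit r -> 1 of [mean_int_le_geo], taken along r = 1 / (1 + e).
    Multiplied by r^(p + 1 + (p - q)), the bound only contains powers of r with
    non-negative exponents, which differ from 1 by O(e). *)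
Theorem hardy_ineq_holds :
  hardy_ineq p q a b (mean f a b) (((p + 1) / p) `^ q) (q / (p + 1) * (b - a)) f.
Proof.
rewrite /hardy_ineq.
have cq0 : 0 < ((p + 1) / p) `^ q by rewrite powR_gt0.
have mix0 : (0 <= mixed_int p q a b f)%E.
  by apply: integral_ge0 => x _; rewrite lee_fin mulr_ge0 ?powR_ge0.
have mean0 : (0 <= mean_int p a b f)%E.
  by apply: integral_ge0 => x _; rewrite lee_fin powR_ge0.
have [Xoo|] := eqVneq (mixed_int p q a b f) +oo%E.
  by rewrite Xoo gt0_muley ?lte_fin// leey.
rewrite -ltey -(ge0_fin_numE mix0) => /fineK/esym hX.
set X := fine _ in hX; rewrite hX.
have GE : q / (p + 1) * (b - a) * mean f a b `^ (- p) = q / (p + 1) * G b.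
  by rewrite /G /potential mulrA.
rewrite GE -EFinM -EFinB.
have : mean_int p a b f \is a fin_num.
  rewrite ge0_fin_numE//; apply: le_lt_trans (ltry _).
  have h2 : (0 < 2^-1 :> R) by rewrite invr_gt0.
  have h1 : (2^-1 < 1 :> R) by lra.
  exact: (mean_int_le_geo h2 h1 hX).
move=> /fineK/esym hY; set Y := fine _ in hY; rewrite hY lee_fin.
have Y0 : 0 <= Y by rewrite -lee_fin -hY.
have Gb0 := ltW (potential_gt0 ab (lexx b)).
have k0 : 0 <= q / (p + 1) by rewrite divr_ge0 ?addr_ge0 ?(ltW p0) ?(ltW q0).
have pq0 : 0 <= p - q by rewrite subr_ge0.
have E0 : 0 <= p + 1 + (p - q).
  by apply: addr_ge0 => //; apply: addr_ge0; [exact: ltW|exact: ler01].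
(* K collects the linear error terms of the two powers of r. *)
set K := Y * (p + 1 + (p - q)) + (q / (p + 1) * G b) * (p - q).
have K0 : 0 <= K.
  apply: addr_ge0.
    by apply: mulr_ge0.
  by apply: mulr_ge0; [exact: mulr_ge0|rewrite subr_ge0].
suff H e : 0 < e -> Y + q / (p + 1) * G b <= ((p + 1) / p) `^ q * X + K * e.
  suff : Y + q / (p + 1) * G b <= ((p + 1) / p) `^ q * X by lra.
  apply/ler_addgt0Pr => e e0.
  have e'0 : 0 < e / (K + 1) by rewrite divr_gt0// ltr_wpDl.
  apply: le_trans (H _ e'0) _; rewrite lerD2l mulrCA ler_piMr ?(ltW e0)//.
  by rewrite ler_pdivrMr ?mul1r ?lerDl// ltr_wpDl.
move=> e0; have e1 : 0 < 1 + e by rewrite addr_gt0.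
pose r := (1 + e)^-1.
have r0 : 0 < r by rewrite invr_gt0.
have r1 : r < 1 by rewrite invf_lt1// ltrDl.
have := mean_int_le_geo r0 r1 hX; rewrite hY lee_fin => h.
have A0 : 0 < r `^ (p + 1 + (p - q)) by rewrite powR_gt0.
have {h} := ler_wpM2l (ltW A0) h.
have -> : r `^ (p + 1 + (p - q)) * (r `^ (- p - 1) * (r `^ (q - p) * ((p + 1) / p) `^ q * X
      - q / (p + 1) * G b)) = ((p + 1) / p) `^ q * X - r `^ (p - q) * (q / (p + 1) * G b).
  rewrite powRD_gt0// -[- p - 1]opprD -[q - p]opprB !powRN.
  field; rewrite !gt_eqF ?powR_gt0//.
  by rewrite addr_gt0.
have h1 : 1 - (p + 1 + (p - q)) * e <= r `^ (p + 1 + (p - q)).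
  exact: powR_ge_linear.
have h2 : 1 - (p - q) * e <= r `^ (p - q).
  exact: powR_ge_linear.
have := ler_wpM2r Y0 h1.
have := ler_wpM2r (mulr_ge0 k0 Gb0) h2.
rewrite /K; lra.
Qed.
End Inequality.

(** * Power functions with a prescribed mean *)

Lemma derivable_pt_lim_exp_ln (k e a w x : R) :
  Rdefinitions.Rlt 0 w -> Rdefinitions.Rlt a x ->
  Ranalysis1.derivable_pt_lim
   (fun t : R => k * Rtrigo_def.exp (e * Rpower.ln (/ w * (t - a))))%coqR x
   (k * (Rtrigo_def.exp (e * Rpower.ln (/ w * (x - a))) *
      (e * (/ (/ w * (x - a)) * (/ w * (1 - 0))))))%coqR.
Proof.
move=> w0 ax.
have y0 : Rdefinitions.Rlt 0 (/ w * (x - a))%coqR.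
  by apply: RIneq.Rmult_lt_0_compat; [exact: RIneq.Rinv_0_lt_compat|exact: RIneq.Rlt_Rminus].
have d1 := Ranalysis1.derivable_pt_lim_scal _ (Rdefinitions.Rinv w) _ _
  (Ranalysis1.derivable_pt_lim_minus _ _ x _ _ (Ranalysis1.derivable_pt_lim_id x)
     (Ranalysis1.derivable_pt_lim_const a x)).
have d2 := Ranalysis1.derivable_pt_lim_comp _ _ _ _ _ d1 (Rpower.derivable_pt_lim_ln _ y0).
have d3 := Ranalysis1.derivable_pt_lim_scal _ e _ _ d2.
have d4 := Ranalysis1.derivable_pt_lim_comp _ _ _ _ _ d3 (Exp_prop.derivable_pt_lim_exp _).
exact: (Ranalysis1.derivable_pt_lim_scal _ k _ _ d4).
Qed.

(** Extended by 0 to the left of a, which makes the power with exponent e + 1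
    differentiable at a itself: the fundamental theorem of calculus then
    applies on the closed interval [a, t]. *)
Definition shifted_power (a w e x : R) : R :=
  (if a < x then ((x - a) / w) `^ e else 0)%R.

Arguments shifted_power (a w e x)%_ring_scope.

Lemma shifted_power_ge0 (a w e x : R) : 0 <= shifted_power a w e x.
Proof. by rewrite /shifted_power; case: ifPn => _; rewrite ?powR_ge0. Qed.

Lemma derivable_pt_lim_shifted_power (k a w e x : R) : 0 < w -> a < x ->
  Ranalysis1.derivable_pt_lim (fun t => (k * shifted_power a w e t)%R) x
    (k * e / w * shifted_power a w (e - 1) x)%R.
Proof.
move=> w0 ax; have /RltP w0' := w0; have /RltP ax' := ax.
have y0 : 0 < (x - a) / w by rewrite divr_gt0// subr_gt0.
have E t : a < t -> (k * Rtrigo_def.exp (e * Rpower.ln (/ w * (t - a))))%coqR =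
    k * shifted_power a w e t.
  move=> at_; have yt : 0 < (t - a) / w by rewrite divr_gt0// subr_gt0.
  rewrite /shifted_power at_ /powR gt_eqF// RexpE RlnE !RealsE.
  by rewrite [w^-1 * _]mulrC.
have := derivable_pt_lim_exp_ln k e w0' ax'.
have -> : (k * (Rtrigo_def.exp (e * Rpower.ln (/ w * (x - a))) *
      (e * (/ (/ w * (x - a)) * (/ w * (1 - 0))))))%coqR =
    k * e / w * shifted_power a w (e - 1) x.
  have -> : shifted_power a w (e - 1) x = shifted_power a w e x / ((x - a) / w).
    by rewrite /shifted_power ax powRD_gt0// powR_inv1// ltW.
  have := E _ ax; rewrite !RealsE mulrA => ->.
  have xa0 : x - a != 0 by rewrite gt_eqF// subr_gt0.
  field; by rewrite xa0 gt_eqF.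
move=> /Derive.is_derive_Reals h; apply/Derive.is_derive_Reals.
apply: Derive.is_derive_ext_loc h.
have xa0 : Rdefinitions.Rlt 0 (x - a)%R by apply/RltP; rewrite subr_gt0.
exists (RIneq.mkposreal _ xa0) => t ht; apply: E.
have [_ /RltP] := Rbasic_fun.Rabs_def2 _ _ ht.
rewrite /Hierarchy.minus /Hierarchy.plus /Hierarchy.opp /= !RealsE; lra.
Qed.

Lemma shifted_power_small (a w e eps : R) : 0 < w -> 0 < e -> 0 < eps ->
  exists2 d, 0 < d & forall x, x < a + d -> shifted_power a w e x < eps.
Proof.
move=> w0 e0 eps0; exists (w * eps `^ e^-1).
  by rewrite mulr_gt0// powR_gt0.
move=> x xd; rewrite /shifted_power; case: ifPn => // ax.
have -> : eps = (eps `^ e^-1) `^ e.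
  by rewrite -powRrM mulVf ?gt_eqF// powRr1// ltW.
rewrite gt0_ltr_powR// ?nnegrE ?powR_ge0//.
  by apply: divr_ge0; rewrite ?subr_ge0; exact: ltW.
rewrite ltr_pdivrMr//; lra.
Qed.

Lemma derivable_pt_lim_shifted_power0 (k a w e : R) : 0 < k -> 0 < w -> 0 < e ->
  Ranalysis1.derivable_pt_lim (fun t => (k * shifted_power a w (e + 1) t)%R) a 0%R.
Proof.
move=> k0 w0 e0 eps /RltP eps0.
have ke0 : 0 < eps * w / k by rewrite divr_gt0// mulr_gt0.
have [d d0 hd] := shifted_power_small a w0 e0 ke0.
have /RltP d0' := d0.
exists (RIneq.mkposreal _ d0') => h h0 /= /Rbasic_fun.Rabs_def2 [/RltP hd' _].
apply/RltP; rewrite RabsE !RealsE subr0.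
have -> : shifted_power a w (e + 1) a = 0 by rewrite /shifted_power ltxx.
rewrite mulr0 subr0.
have := hd (a + h); rewrite ltrD2l => /(_ hd').
rewrite /shifted_power ltrDl; case: ifPn => hp; last first.
  by rewrite mulr0 mul0r normr0.
have -> : a + h - a = h by ring.
have hw : 0 < h / w by rewrite divr_gt0.
rewrite powRD_gt0// powRr1 ?(ltW hw)// => hh.
have -> : k * ((h / w) `^ e * (h / w)) / h = k / w * (h / w) `^ e.
  by field; rewrite !gt_eqF.
rewrite gtr0_norm; last by rewrite !mulr_gt0 ?invr_gt0 ?powR_gt0.
move: hh; rewrite ltr_pdivlMr// => hh.
by rewrite mulrAC ltr_pdivrMr// [k * _]mulrC.
Qed.

Lemma continuity_pt_shifted_power (k a w e x : R) : 0 <= k -> 0 < w -> 0 < e -> a <= x ->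
  Ranalysis1.continuity_pt (fun t => (k * shifted_power a w e t)%R) x.
Proof.
move=> k0 w0 e0; rewrite le_eqVlt => /predU1P[<-|ax]; last first.
  have h := derivable_pt_lim_shifted_power k e w0 ax.
  exact: (Ranalysis1.derivable_continuous_pt _ _ (exist _ _ h)).
move=> eps /RltP eps0.
have ke0 : 0 < eps / (k + 1) by rewrite divr_gt0// ltr_wpDl.
have [d d0 hd] := shifted_power_small a w0 e0 ke0.
exists d; split; first exact/RltP.
move=> t [_ /= /Rbasic_fun.Rabs_def2 [/RltP + _]]; rewrite RminusE => td.
apply/RltP; rewrite /Rfunctions.Rdist RabsE RminusE.
have -> : shifted_power a w e a = 0 by rewrite /shifted_power ltxx.
rewrite mulr0 subr0 ger0_norm ?mulr_ge0 ?shifted_power_ge0//.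
have k1 : 0 < k + 1 by rewrite ltr_wpDl.
have := hd t; rewrite (ltr_pdivlMr _ _ k1) => hh.
apply: le_lt_trans (hh _); last by lra.
by rewrite mulrC ler_wpM2l ?shifted_power_ge0// lerDl.
Qed.

(** A multiple of a power of t - a, made positive at a, where the power
    vanishes.  The factor 1 + al makes the mean over [a, b] equal to l. *)
Definition power_example (a b l al t : R) : R :=
  (if a < t then l * (1 + al) * ((t - a) / (b - a)) `^ al else l)%R.

Arguments power_example (a b l al t)%_ring_scope.

Section PowerExample.
Variables (a b l al : R).
Hypotheses (ab : a < b) (l0 : 0 < l) (al0 : 0 < al).
Let f := power_example a b l al.
Let w0 : 0 < b - a. Proof. by rewrite subr_gt0. Qed.

Lemma power_example_gt0 (t : R) : 0 < f t.
Proof.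
rewrite /f /power_example; case: ifPn => // at_.
by rewrite !mulr_gt0 ?addr_gt0// powR_gt0// divr_gt0// subr_gt0.
Qed.

Lemma is_RInt_power_example (t : R) : a < t ->
  @RInt.is_RInt Hierarchy.R_NormedModule f a t
    (l * (b - a) * ((t - a) / (b - a)) `^ (al + 1))%R.
Proof.
move=> at_.
pose k := l * (b - a); have k0 : 0 < k by rewrite mulr_gt0.
pose Phi (x : R) : R := (k * shifted_power a (b - a) (al + 1) x)%R.
pose phi (x : R) : R := (l * (1 + al) * shifted_power a (b - a) al x)%R.
have /RltP/RIneq.Rlt_le at' := at_.
have H : @RInt.is_RInt Hierarchy.R_NormedModule phi a t
    (@Hierarchy.minus Hierarchy.R_AbelianGroup (Phi t) (Phi a)).
  apply: (@RInt_analysis.is_RInt_derive Hierarchy.R_CompleteNormedModule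
            Phi phi a t) => x; rewrite Rbasic_fun.Rmin_left// => -[/RleP ax _].
    apply/Derive.is_derive_Reals; move: ax; rewrite le_eqVlt => /predU1P[<-|ax].
      have -> : phi a = 0 by rewrite /phi /shifted_power ltxx mulr0.
      exact: derivable_pt_lim_shifted_power0.
    have -> : phi x = k * (al + 1) / (b - a) * shifted_power a (b - a) (al + 1 - 1) x.
      rewrite addrK /phi /k; field; by rewrite gt_eqF.
    exact: derivable_pt_lim_shifted_power.
  apply/Hierarchy.continuity_pt_filterlim.
  apply: continuity_pt_shifted_power => //.
  by rewrite mulr_ge0 ?addr_ge0 ?(ltW l0) ?(ltW al0).
have e : @Hierarchy.minus Hierarchy.R_AbelianGroup (Phi t) (Phi a) =
    l * (b - a) * ((t - a) / (b - a)) `^ (al + 1).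
  rewrite /Hierarchy.minus /Hierarchy.plus /Hierarchy.opp /= !RealsE.
  by rewrite /Phi /shifted_power ltxx at_ mulr0 oppr0 addr0.
rewrite -e; apply: RInt.is_RInt_ext H => x.
rewrite Rbasic_fun.Rmin_left// => -[/RltP ax _].
by rewrite /phi /f /power_example /shifted_power ax.
Qed.

Lemma mean_power_example (t : R) : a < t ->
  mean f a t = l * ((t - a) / (b - a)) `^ al.
Proof.
move=> at_; rewrite /mean /riemann_int.
rewrite (@RInt.is_RInt_unique Hierarchy.R_CompleteNormedModule _ _ _ _ (is_RInt_power_example at_)).
have y0 : 0 < (t - a) / (b - a) by rewrite divr_gt0// subr_gt0.
rewrite powRD_gt0// powRr1 ?(ltW y0)//; field.
by rewrite !subr_eq0 !gt_eqF.
Qed.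

Lemma power_example_admissible : admissible a b l f.
Proof.
split.
- by exists (l * (b - a) * ((b - a) / (b - a)) `^ (al + 1)); exact: is_RInt_power_example.
- by move=> t _; exact: power_example_gt0.
- by rewrite mean_power_example// divff ?powR1 ?mulr1// gt_eqF.
Qed.
End PowerExample.

(** * Sharpness *)

Section Sharpness.
Variables (p q a b l al : R).
Hypotheses (p0 : 0 < p) (ab : a < b) (l0 : 0 < l).
Hypotheses (al0 : 0 < al) (alp : al * p < 1).
Let f := power_example a b l al.
Let w0 : 0 < b - a. Proof. by rewrite subr_gt0. Qed.

(** The mean is increasing, so on each cell M^-p is at most its value at the
    left end.  The sum of these bounds is estimated by [geometric_sum_le] with
    exponent 1 - al p, up to a factor 1 / r that tends to 1. *)
Lemma mean_int_power_example_le :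
  (mean_int p a b f <= (l `^ (- p) * (b - a) / (1 - al * p))%:E)%E.
Proof.
set B := l `^ (- p) * (b - a) / (1 - al * p).
have g0 : 0 < 1 - al * p by rewrite subr_gt0.
have B0 : 0 < B by rewrite !mulr_gt0 ?invr_gt0// powR_gt0.
apply/lee_addgt0Pr => e e0.
have eB : 0 < e / B by rewrite divr_gt0.
pose r := (1 + e / B)^-1.
have d1 : 0 < 1 + e / B by rewrite addr_gt0.
have r0 : 0 < r by rewrite invr_gt0.
have r1 : r < 1 by rewrite invf_lt1// ltrDl.
have rk k : 0 < r ^+ k by rewrite exprn_gt0.
apply: (@integral_le_sum_cells _ _ r _ _ _ _
          (fun i => (l * (r ^+ i.+1) `^ al) `^ (- p))) => //.
- by move=> x _; rewrite powR_ge0.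
- by move=> i; rewrite powR_ge0.
- move=> i x /andP[ix xi].
  have ax : a < x by rewrite (lt_trans _ ix)// geo_gt.
  have u0 : 0 < (r ^+ i.+1) `^ al by rewrite powR_gt0.
  rewrite mean_power_example//; apply: ge0_powRN_anti; [exact: ltW|exact: mulr_gt0|].
  rewrite ler_pM2l// ge0_ler_powR ?(ltW al0)// ?nnegrE ?(ltW (rk _))//.
    by apply: divr_ge0; rewrite ?subr_ge0; exact: ltW.
  by rewrite ler_pdivlMr// mulrC -geoB lerD2r ltW.
move=> n.
have -> : \sum_(i < n) (l * (r ^+ i.+1) `^ al) `^ (- p)
      * (geo a b r i - geo a b r i.+1) =
   l `^ (- p) * (b - a) / r * ((1 - r) * \sum_(i < n) (r `^ (1 - al * p)) ^+ i.+1).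
  rewrite mulrA mulr_sumr; apply: eq_bigr => i _.
  have -> : (r `^ (1 - al * p)) ^+ i.+1 = r ^+ i.+1 * ((r ^+ i.+1) `^ al) `^ (- p).
    rewrite -powR_mulrn ?powR_ge0// -powRrM mulrC powRrM powR_mulrn ?(ltW r0)//.
    by rewrite powRD_gt0// powRr1 ?(ltW (rk _))// -powRrM mulrN.
  rewrite geo_width geoB powRM ?powR_ge0 ?(ltW l0)// exprS.
  field; by rewrite gt_eqF.
apply: (@le_trans _ _ (l `^ (- p) * (b - a) / r * (1 - al * p)^-1)).
  rewrite ler_wpM2l ?geometric_sum_le//.
  by apply/ltW; apply: divr_gt0 => //; apply: mulr_gt0 => //; rewrite powR_gt0.
have -> : l `^ (- p) * (b - a) / r * (1 - al * p)^-1 = B * r^-1.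
  by rewrite mulrAC.
have scale x : 0 < x -> x * (1 + e / x)^-1^-1 = x + e.
  by move=> x0; rewrite invrK; field; rewrite gt_eqF.
by rewrite /r scale.
Qed.

(** f = (1 + al) M holds on ]a, b] but not at a. *)
Lemma mixed_int_power_example_le :
  (mixed_int p q a b f <= ((1 + al) `^ (- q))%:E * mean_int p a b f)%E.
Proof.
have al1 : 0 < 1 + al by rewrite addr_gt0.
have k0 : 0 < (1 + al) `^ (- q) by rewrite powR_gt0.
rewrite /mean_int.
apply: (@le_trans _ _ (\int[mu]_(x in (`[a, b] : set R))
    (((1 + al) `^ (- q))%:E * (mean f a x `^ (- p))%:E))%E); last first.
  by apply: integral_scale_le => // x _; rewrite lee_fin powR_ge0.
apply: (@le_integral_off_null _ _ _ mu _ [set a]) => //.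
- exact: measurable_set1_completed.
- exact: completed_lebesgue_measure_set1.
- by move=> x _; rewrite lee_fin mulr_ge0 ?powR_ge0.
- by move=> x _; rewrite -EFinM lee_fin mulr_ge0 ?powR_ge0.
move=> x /=; rewrite in_itv/= => /andP[ax _] /eqP nax.
have {}ax : a < x by rewrite lt_neqAle eq_sym nax.
rewrite -EFinM lee_fin.
have M0 : 0 < mean f a x.
  by rewrite mean_power_example// mulr_gt0// powR_gt0// divr_gt0// subr_gt0.
have -> : f x = (1 + al) * mean f a x.
  by rewrite mean_power_example// /f /power_example ax; ring.
rewrite (powRM _ (ltW al1) (ltW M0)) mulrCA -powRD_gt0//.
by have -> : - p + q + - q = - p by ring.
Qed.

(** X is the integral of M^-p. *)
Lemma hardy_ineq_power_example (C D : R) : 0 <= C ->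
  hardy_ineq p q a b l C D f ->
  exists2 X : R, 0 <= X <= l `^ (- p) * (b - a) / (1 - al * p) &
    D * l `^ (- p) <= (C * (1 + al) `^ (- q) - 1) * X.
Proof.
move=> C0 h.
have X0 : (0 <= mean_int p a b f)%E.
  by apply: integral_ge0 => x _; rewrite lee_fin powR_ge0.
have XB := mean_int_power_example_le.
have : mean_int p a b f \is a fin_num.
  by rewrite ge0_fin_numE//; exact: le_lt_trans XB (ltry _).
move=> /fineK/esym hX; set X := fine _ in hX.
exists X; first by rewrite -!lee_fin -hX X0 XB.
have : (mean_int p a b f <= C%:E * (((1 + al) `^ (- q))%:E * mean_int p a b f)
     - (D * l `^ (- p))%:E)%E.
  apply: le_trans h _; apply: leeB => //; apply: lee_wpmul2l => //.
  exact: mixed_int_power_example_le.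
rewrite hX -!EFinM -EFinB lee_fin; lra.
Qed.
End Sharpness.

Theorem theorem1 (p q a b l : R) (hq : 0 < q) (hpq : q <= p)
    (hab : a < b) (hl : 0 < l) :
  [/\ forall f : R -> R, admissible a b l f ->
        hardy_ineq p q a b l
          (((p + 1) / p) `^ q) (q / (p + 1) * (b - a)) f,
      forall C : R, C < ((p + 1) / p) `^ q ->
        ~ (forall f : R -> R, admissible a b l f ->
             hardy_ineq p q a b l C (q / (p + 1) * (b - a)) f) &
      forall D : R, q / (p + 1) * (b - a) < D ->
        ~ (forall f : R -> R, admissible a b l f ->
             hardy_ineq p q a b l (((p + 1) / p) `^ q) D f)].
Proof.
have p0 : 0 < p by exact: lt_le_trans hq hpq.
have p1 : 0 < p + 1 by rewrite addr_gt0.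
have c0 : 0 < (p + 1) / p by rewrite divr_gt0.
have ba0 : 0 < b - a by rewrite subr_gt0.
have lp0 : 0 < l `^ (- p) by rewrite powR_gt0.
have k0 : 0 < q / (p + 1) * (b - a) by rewrite mulr_gt0// divr_gt0.
split.
- by move=> f [fi f0 <-]; exact: hardy_ineq_holds.
- move=> C hC hall.
  (* The exponent al is chosen with (1 + al)^q = C0.  Since C1 is the value for
     al = 1 / (2 p), raising C to at least C1 keeps al positive. *)
  pose C1 := (1 + (p *+ 2)^-1) `^ q.
  have p2 : 0 < (p *+ 2)^-1 by rewrite invr_gt0 pmulrn_rgt0.
  have d0 : 0 < 1 + (p *+ 2)^-1 by rewrite addr_gt0.
  have C1lt : C1 < ((p + 1) / p) `^ q.
    rewrite gt0_ltr_powR// ?nnegrE ?ltW//.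
    rewrite mulrDl divff ?gt_eqF// mul1r ltrD2l ltf_pV2 ?posrE ?pmulrn_rgt0//.
    by rewrite mulr2n ltrDl.
  pose C0 := Num.max C C1.
  have C0C1 : C1 <= C0 by rewrite le_max lexx orbT.
  have C0pos : 0 < C0 by rewrite (lt_le_trans _ C0C1)// powR_gt0.
  have C0lt : C0 < ((p + 1) / p) `^ q by rewrite gt_max hC.
  pose al := C0 `^ q^-1 - 1.
  have root x : 0 < x -> (x `^ q) `^ q^-1 = x.
    by move=> x0; rewrite -powRrM mulfV ?gt_eqF// powRr1// ltW.
  have qV0 : 0 < q^-1 by rewrite invr_gt0.
  have al0 : 0 < al.
    rewrite subr_gt0; apply: (@lt_le_trans _ _ (1 + (p *+ 2)^-1)).
      by rewrite ltrDl.
    by rewrite -(root _ d0) ge0_ler_powR ?(ltW qV0) ?nnegrE ?powR_ge0 ?(ltW C0pos).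
  have alp : al * p < 1.
    have : C0 `^ q^-1 < (p + 1) / p.
      by rewrite -(root _ c0) gt0_ltr_powR ?nnegrE ?powR_ge0 ?(ltW C0pos).
    rewrite ltr_pdivlMr// /al; lra.
  have alq : (1 + al) `^ q = C0.
    by rewrite /al addrC subrK -powRrM mulVf ?gt_eqF// powRr1// ltW.
  have hf := hall _ (power_example_admissible hab hl al0).
  have hf0 : hardy_ineq p q a b l C0 (q / (p + 1) * (b - a)) (power_example a b l al).
    apply: le_trans hf _; apply: leeB => //; apply: lee_wpmul2r.
      by apply: integral_ge0 => x _; rewrite lee_fin mulr_ge0 ?powR_ge0.
    by rewrite lee_fin le_max lexx.
  have [X _] := hardy_ineq_power_example p0 hab hl al0 alp (ltW C0pos) hf0.
  rewrite [(1 + al) `^ _]powRN alq divff ?gt_eqF// subrr mul0r leNgt.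
  by rewrite mulr_gt0.
- move=> D hD hall.
  have D0 : 0 < D by exact: lt_trans k0 hD.
  set k := q / (p + 1) * (b - a) in k0 hD.
  (* With 1 + al = (1 - u) (p + 1) / p, the ratio of the gain
     (1 - u)^-q - 1 to 1 - al p = (p + 1) u is at most
     q / (p + 1) / (1 - (1 + q) u).  The first bound on u makes al positive;
     the second makes D (1 - (1 + q) u) exceed k. *)
  pose u := Num.min (((p + 1) *+ 2)^-1) ((D - k) / (D * (1 + q) *+ 2)).
  have q1 : 0 < 1 + q by rewrite addr_gt0.
  have Dq : 0 < D * (1 + q) by rewrite mulr_gt0.
  have u0 : 0 < u.
    rewrite lt_min; apply/andP; split; first by rewrite invr_gt0 pmulrn_rgt0.
    by rewrite divr_gt0 ?subr_gt0// pmulrn_rgt0.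
  have u1 : u * ((p + 1) *+ 2) <= 1.
    by rewrite -ler_pdivlMr ?pmulrn_rgt0// mul1r ge_min lexx.
  have u2 : u * (D * (1 + q) *+ 2) <= D - k.
    by rewrite -ler_pdivlMr ?pmulrn_rgt0// ge_min lexx orbT.
  pose al := (p + 1) / p * (1 - u) - 1.
  have alE : al * p = 1 - (p + 1) * u by rewrite /al; field; rewrite gt_eqF.
  have up : 0 < u * (p + 1) by rewrite mulr_gt0.
  have al0 : 0 < al by rewrite -(pmulr_lgt0 _ p0) alE; lra.
  have alp : al * p < 1 by rewrite alE; lra.
  have hf := hall _ (power_example_admissible hab hl al0).
  have [X /andP[X0 XB]] := hardy_ineq_power_example p0 hab hl al0 alp (ltW (powR_gt0 _ c0)) hf.
  have uu : 0 < 1 - u by have := mulr_gt0 p0 u0; lra.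
  have uq : (1 + q) * u < 1.
    have : D * ((1 + q) * u) < D * 1 by have := mulr_gt0 Dq u0; lra.
    by rewrite ltr_pM2l.
  have -> : ((p + 1) / p) `^ q * (1 + al) `^ (- q) = ((1 - u) `^ q)^-1.
    have -> : 1 + al = (p + 1) / p * (1 - u) by rewrite /al; ring.
    rewrite (powRM _ (ltW c0) (ltW uu)) !powRN mulrA divff ?mul1r//.
    by rewrite gt_eqF// powR_gt0.
  have tg : (1 - (1 + q) * u) / (1 - u) <= (1 - u) `^ q.
    have := powRN_ge_tangent1 (ltW hq) (_ : 0 < (1 - u)^-1).
    rewrite invr_gt0 uu => /(_ isT).
    rewrite -(powR_inv1 (ltW uu)) -powRrM mulrN mulN1r opprK powR_inv1 ?(ltW uu)//.
    apply: le_trans; rewrite le_eqVlt; apply/orP; left; apply/eqP.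
    field; by rewrite gt_eqF.
  have uq0 : 0 < 1 - (1 + q) * u by lra.
  have inv_le : ((1 - u) `^ q)^-1 - 1 <= q * u / (1 - (1 + q) * u).
    have : ((1 - u) `^ q)^-1 <= ((1 - (1 + q) * u) / (1 - u))^-1.
      by rewrite lef_pV2 ?posrE ?powR_gt0// divr_gt0.
    rewrite invf_div => h; rewrite lerBlDr (le_trans h)// le_eqVlt.
    apply/orP; left; apply/eqP; field; by rewrite gt_eqF.
  move=> hD1.
  have : D * l `^ (- p) <= q * u / (1 - (1 + q) * u) *
      (l `^ (- p) * (b - a) / (1 - al * p)).
    apply: le_trans hD1 _.
    apply: (@le_trans _ _ (q * u / (1 - (1 + q) * u) * X)); first exact: ler_wpM2r.
    apply: ler_wpM2l => //; apply: divr_ge0; last exact: ltW.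
    by apply: mulr_ge0; exact: ltW.
  have -> : 1 - al * p = (p + 1) * u by rewrite alE; ring.
  have -> : q * u / (1 - (1 + q) * u) * (l `^ (- p) * (b - a) / ((p + 1) * u)) =
     k / (1 - (1 + q) * u) * l `^ (- p).
    rewrite /k; field; by rewrite !gt_eqF.
  rewrite ler_pM2r// ler_pdivlMr//.
  have := mulr_gt0 Dq u0; lra.
Qed.
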